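(* For every integer $r \geq 1$ there exists a polynomial $\tilde P_r$ with $\deg \tilde P_r \leq 3r-3$ such that the generating function $$F_r(t) = \sum_{n=r+1}^\infty M_n^{(n-r)} t^n$$ satisfies, after the change of variables $t = w/(1+w)^2$, the identity of formal power series in $w$ $$F_r\!\left(\frac{w}{(1+w)^2}\right) = \sum_{n=r+1}^\infty M_n^{(n-r)} \frac{w^n}{(1+w)^{2n}} = \frac{w^{r+1}(1+w)}{(1-w)^{2r-1}}\, \tilde P_r(w).$$
   Context: For $n \geq 1$, let $NC_2(2n)$ denote the set of non-crossing pair partitions (perfect matchings with no two pairs $\{a,b\},\{c,d\}$ satisfying $a<c<b<d$) of $\{1,\dots,2n\}$. A meandric system on $2n$ points is a pair $(P,Q) \in NC_2(2n)^2$ (thought of as arches drawn above and below a horizontal line through $2n$ points); its loops are the connected components of the graph on vertex set $\{1,\dots,2n\}$ whose edge multiset is the union of the pairs of $P$ and of $Q$ (each component is a cycle). $M_n^{(k)}$ denotes the number of meandric systems on $2n$ points having exactly $k$ loops. *)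

(* Defs.v *)
From mathcomp Require Import all_boot all_order all_algebra.

Set Implicit Arguments.
Unset Strict Implicit.
Unset Printing Implicit Defensive.

Import GRing.Theory.

Local Open Scope nat_scope.

(** Non-crossing pairings; the points 1, ..., m are the elements 0, ..., m-1
    of ['I_m], in the same order. *)

Definition pair_partition (m : nat) (P : {set {set 'I_m}}) : bool :=
  partition P [set: 'I_m] && [forall B in P, #|B| == 2].

Definition crossing (m : nat) (P : {set {set 'I_m}}) : bool :=
  [exists a : 'I_m, exists b : 'I_m, exists c : 'I_m, exists d : 'I_m,
    [&& [set a; b] \in P, [set c; d] \in P, a < c, c < b & b < d]].

Definition NC2 (m : nat) : {set {set {set 'I_m}}} :=
  [set P | pair_partition P && ~~ crossing P].

(** Edge multiplicities do not affect connected components, so a relation is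
    enough. It has no self-loops when all blocks have two elements. *)
Definition meander_edge (m : nat) (P Q : {set {set 'I_m}}) : rel 'I_m :=
  fun x y => ([set x; y] \in P) || ([set x; y] \in Q).

(** [n_comp] counts connected components only for a symmetric [connect]. *)
Lemma meander_edge_connect_sym (m : nat) (P Q : {set {set 'I_m}}) :
  connect_sym (meander_edge P Q).
Proof.
by apply: sym_connect_sym => x y; rewrite /meander_edge setUC.
Qed.

Definition loops (m : nat) (P Q : {set {set 'I_m}}) : nat :=
  n_comp (meander_edge P Q) 'I_m.

Definition meandric_systems (n : nat) :
    {set {set {set 'I_(2 * n)}} * {set {set 'I_(2 * n)}}} :=
  setX (NC2 (2 * n)) (NC2 (2 * n)).

Definition meandric_number (n k : nat) : nat :=
  #|[set PQ in meandric_systems n | loops PQ.1 PQ.2 == k]|.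

Local Open Scope ring_scope.

(** Formal power series, as coefficient sequences compared pointwise. *)

Definition fps (R : Type) : Type := nat -> R.

Section FPS.
Variable R : comUnitRingType.
Implicit Types (f g s : fps R) (p q : {poly R}).

Definition fps_of_poly p : fps R := fun n => p`_n.

Definition fps_one : fps R := fun n => (n == 0)%:R.

Definition fps_mul f g : fps R :=
  fun n => \sum_(i < n.+1) f i * g (n - i)%N.

Definition fps_exp f (n : nat) : fps R := iter n (fps_mul f) fps_one.

(** The first [n] coefficients of the inverse [g] of [f], from
    [g_0 = 1 / f_0] and [g_m = - (f_m g_0 + ... + f_1 g_(m-1)) / f_0]. *)
Fixpoint fps_inv_seq f (n : nat) : seq R :=
  if n is m.+1 then
    let s := fps_inv_seq f m in
    rcons s ((f 0)^-1 * ((m == 0)%:R - \sum_(i < m) f (m - i)%N * s`_i))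
  else [::].

(** Meaningful when the constant coefficient of [f] is a unit. *)
Definition fps_inv f : fps R := fun n => (fps_inv_seq f n.+1)`_n.

Definition fps_div f g : fps R := fps_mul f (fps_inv g).

(** The composite [f(g)], meaningful when [g 0 = 0]: then [g ^ n] has no term
    of degree less than [n], so the terms [f n * g ^ n] with [n > k] do not
    contribute to the coefficient of degree [k]. *)
Definition fps_comp f g : fps R :=
  fun k => \sum_(n < k.+1) f n * fps_exp g n k.

(** [s] is the sum of the [u n] for [n >= m], for the usual topology: each
    coefficient of the partial sums is eventually constant. *)
Definition fps_is_sum (m : nat) (u : nat -> fps R) s : Prop :=
  forall k, exists N0 : nat, forall N : nat, (N0 <= N)%N ->
    \sum_(m <= n < N) u n k = s k.

Lemma size_fps_inv_seq f n : size (fps_inv_seq f n) = n.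
Proof. by elim: n => //= n IHn; rewrite size_rcons IHn. Qed.

Lemma nth_fps_inv_seq f n i : (i < n)%N -> (fps_inv_seq f n)`_i = fps_inv f i.
Proof.
elim: n => // n IHn; rewrite ltnS leq_eqVlt => /predU1P[-> //|lt_in].
by rewrite /= nth_rcons size_fps_inv_seq lt_in IHn.
Qed.

Lemma fps_mulV f : f 0 \is a GRing.unit -> fps_mul f (fps_inv f) =1 fps_one.
Proof.
move=> f0u n; rewrite /fps_mul (reindex_inj rev_ord_inj) /=.
under eq_bigr => i _ do rewrite subSS subKn ?leq_ord //.
rewrite big_ord_recr /= subnn {2}/fps_inv /= nth_rcons size_fps_inv_seq.
rewrite ltnn eqxx mulVKr // addrC.
under [X in _ - X]eq_bigr => i _ do rewrite nth_fps_inv_seq //.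
by rewrite subrK.
Qed.

End FPS.

(** [F_r(t)], the sum over [n >= r+1] of [M_n^(n-r) t^n]. *)
Definition meandric_gf (r : nat) : fps rat :=
  fun n => if (r < n)%N then (meandric_number n (n - r))%:R else 0.

(* Main.v *)
From HB Require Import structures.
Require Import Defs.
From mathcomp Require Import all_boot all_order all_algebra.
From mathcomp Require Import boolp.
From mathcomp Require Import zify ring.

(**
  A meandric system is a word over pairs of parentheses. Call a pair common to
  both pairings a circle. Removing a circle lowers the number of points by two
  and the number of loops by one, so it preserves r = n - loops. A system is
  thus a circle-free system with a sequence of circles, each enclosing an
  arbitrary system, inserted in each gap. With y marking r, this reads
    M = sum_l k_l t^l V^(2l+1),   V = 1 / (1 - t M),
  where k_l counts the circle-free systems on 2l points. Their loops have at
  least four points, so y^s occurs in k_l only if s < l <= 2s (or s = l = 0).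
  Put w = M(y = 0) - 1, so that t = w / (1+w)^2, and M = (1 + w)(1 + G). The
  equation becomes
    (1 + G)(1 - w G) = sum_l k_l w^l U^(2l),   U = 1 / (1 - w G),
  and the coefficient of y^r expresses (1 - w) G_r through G_1, ..., G_(r-1);
  by induction (1 - w)^(2r-1) G_r is w^(r+1) times a polynomial in w of degree
  at most 3r - 3.
*)

Set Implicit Arguments.
Unset Strict Implicit.
Unset Printing Implicit Defensive.

Import Order.TTheory GRing.Theory Num.Theory.

Local Open Scope nat_scope.

(** * Dyck words *)

(** The decomposition into a core with circles is not built as a bijection. Words over all four
    letters are summed against a weight that vanishes off systems, and splitting off one letter at a
    time yields a linear equation for each generating series. The counting keeps y inside polynomial
    coefficients of series in t; the two variables are then exchanged, so that y grades series in t.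
    There w is itself a series in t, and only the last step substitutes t = w/(1+w)^2, which turns
    this series into the variable. Origin of the exponents: in the coefficient of y^r, a core factor
    y^s has s >= 1, so it meets powers of U only at index r - s, whose denominator (1-w)^(2(r-s))
    has exponent at most 2r - 2; dividing by 1 - w gives 2r - 1. The bound s < l gives the factor
    w^(r+1), and the bound l <= 2s gives the degree: the extreme case l = 2s uses up exactly 3r - 3,
    while the products w G_i G_(r-i) stay within 3r - 4. *)

Fixpoint dyck_from (p : nat) (d : seq bool) : bool :=
  match d with
  | [::] => p == 0
  | true :: d' => dyck_from p.+1 d'
  | false :: d' => if p is p'.+1 then dyck_from p' d' else false
  end.

Local Notation dyck := (dyck_from 0).

Lemma dyck_from_cat p r v w :
  dyck_from r v -> dyck_from (p + r) (v ++ w) = dyck_from p w.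
Proof.
elim: v r => [|[] v IHv] [|r] //=; rewrite ?addn0 //.
- by move/IHv <-; rewrite addn1.
- by move/IHv <-; rewrite !addnS.
- by move/IHv <-; rewrite addnS.
Qed.

Lemma dyck_cat_insert p pre v w :
  dyck v -> dyck_from p (pre ++ v ++ w) = dyck_from p (pre ++ w).
Proof.
move=> dv; elim: pre p => [|[] pre IHpre] [|p] //=.
  by rewrite -{1}[0]addn0 dyck_from_cat.
by rewrite -[p.+1]addn0 dyck_from_cat ?addn0.
Qed.

Fixpoint hgt (d : seq bool) (k : nat) : int :=
  match d, k with
  | c :: d', k'.+1 => ((if c then 1 else -1) + hgt d' k')%R
  | _, _ => 0%R
  end.

Lemma hgt0 d : hgt d 0 = 0%R. Proof. by case: d. Qed.

Lemma hgt_cat u v k : hgt (u ++ v) k = (hgt u k + hgt v (k - size u))%R.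
Proof.
elim: u k => [|c u IHu] [|k] //=; rewrite ?hgt0 ?add0r ?subn0 //.
by rewrite IHu addrA subSS.
Qed.

Lemma hgt_oversize d k : size d <= k -> hgt d k = hgt d (size d).
Proof. by elim: d k => [|c d IHd] [|k] //= /IHd ->. Qed.

Lemma hgtS d k : hgt d k.+1 =
  (hgt d k + (if (k < size d)%N then if nth false d k then 1 else -1 else 0))%R.
Proof.
elim: d k => [|c d IHd] [|k] //=; first by rewrite !hgt0 add0r addr0.
by rewrite -[RHS]addrA ltnS -IHd.
Qed.

Lemma dyck_fromP p d :
  reflect ((forall k, (0 <= p%:Z + hgt d k)%R) /\ (p%:Z + hgt d (size d) = 0)%R)
          (dyck_from p d).
Proof.
elim: d p => [|c d IHd] p /=.
  apply: (iffP eqP) => [->|[_]]; last by lia.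
  by split=> // k; lia.
case: c; last first.
  case: p => [|p].
    by apply: (iffP idP) => // -[/(_ 1)]; rewrite /= hgt0; lia.
  apply: (iffP (IHd p)) => -[h0 h1]; split; try lia.
    by case=> [|k]; [lia | have := h0 k; lia].
  by move=> k; have := h0 k.+1; lia.
apply: (iffP (IHd p.+1)) => -[h0 h1]; split; try lia.
  by case=> [|k]; [lia | have := h0 k; lia].
by move=> k; have := h0 k.+1; lia.
Qed.

Lemma dyckP d :
  reflect ((forall k, (0 <= hgt d k)%R) /\ (hgt d (size d) = 0)%R) (dyck d).
Proof.
apply: (iffP (dyck_fromP 0 d)) => -[h0 h1]; rewrite ?add0r in h1 *;
  by split=> // k; have := h0 k; rewrite add0r.
Qed.

(* The opening letter [i] is closed by the letter [j]. *)
Definition matched (d : seq bool) (i j : nat) : bool :=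
  [&& i < j, hgt d j.+1 == hgt d i
    & all (fun k => (hgt d i < hgt d k)%R) (iota i.+1 (j - i))].

Lemma matchedP d i j :
  reflect [/\ i < j, hgt d j.+1 = hgt d i
            & forall k, i < k <= j -> (hgt d i < hgt d k)%R]
          (matched d i j).
Proof.
apply: (iffP and3P) => -[ltij /eqP eqh allh]; split=> //.
  by move=> k ik; apply: (allP allh); rewrite mem_iota; lia.
by apply/allP => k; rewrite mem_iota => ik; apply: allh; lia.
Qed.

Definition linked d i j := matched d i j || matched d j i.

Lemma linkedC d i j : linked d i j = linked d j i.
Proof. exact: orbC. Qed.

(** Heights are constant past the end of the word, so the strict descent from [j] to [j.+1] can only
    happen inside it. *)
Lemma matched_letters d i j : matched d i j ->
  [/\ j < size d, nth false d i & ~~ nth false d j].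
Proof.
case/matchedP=> ltij eqh allh.
have hi := allh i.+1; have hj := allh j.
have := hgtS d i; have := hgtS d j.
case: (ltnP j (size d)) => [lt_j|_]; last by lia.
rewrite (ltn_trans ltij lt_j).
by case: (nth false d i); case: (nth false d j) => e1 e2; split=> //; lia.
Qed.

Lemma matched_fun d i j j' : matched d i j -> matched d i j' -> j = j'.
Proof.
move=> /matchedP[h1 h2 h3] /matchedP[h1' h2' h3'].
have [|ltjj'|ltj'j] := ltngtP j j' => //.
  by have := h3' j.+1; lia.
by have := h3 j'.+1; lia.
Qed.

Lemma matched_inj d i i' j : matched d i j -> matched d i' j -> i = i'.
Proof.
move=> /matchedP[h1 h2 h3] /matchedP[h1' h2' h3'].
have [ltii'|ltii'|] := ltngtP i i' => //.
  by have := h3 i'; lia.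
by have := h3' i; lia.
Qed.

Lemma matched_no_chain d i j k : matched d i j -> matched d j k -> False.
Proof.
move=> /matched_letters[_ _ /negP h] /matched_letters[_ h' _]; exact: h.
Qed.

Lemma linked_fun d i j j' : linked d i j -> linked d i j' -> j = j'.
Proof.
case/orP=> m1 /orP[] m2.
- exact: matched_fun m1 m2.
- by case: (matched_no_chain m2 m1).
- by case: (matched_no_chain m1 m2).
- exact: matched_inj m1 m2.
Qed.

Lemma linked_irr d i : linked d i i = false.
Proof. by rewrite /linked orbb /matched ltnn. Qed.

(** The partner is the step that first brings the height back to [hgt d i]; the final height 0
    guarantees a return. *)
Lemma matched_exists d i : dyck d -> i < size d -> nth false d i ->
  exists j, matched d i j.
Proof.
move=> /dyckP[h0 h1] lt_i up_i.
have ex : exists k, (i < k) && (hgt d k <= hgt d i)%R.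
  by exists (size d); rewrite lt_i h1 h0.
case: (ex_minnP ex) => -[//|j] /andP[lt_ij le_h] minj; exists j.
have h2 k : i < k <= j -> (hgt d i < hgt d k)%R.
  by move=> k_ij; rewrite ltNge; apply/negP=> h; have := minj k; rewrite h; lia.
have h3 := hgtS d i; rewrite lt_i up_i in h3.
have ltij : i < j.
  by rewrite ltn_neqAle -ltnS lt_ij andbT; apply/eqP => eq_ij; subst j; lia.
apply/matchedP; split=> //.
by have := h2 j; have := hgtS d j; case: ifP => _; try case: nth; lia.
Qed.

(** Mirror image: the partner starts at the last position up to [j] whose height is at most
    [hgt d j.+1]. *)
Lemma matched_exists_down d j : dyck d -> j < size d -> ~~ nth false d j ->
  exists i, matched d i j.
Proof.
move=> /dyckP[h0 h1] lt_j down_j.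
have ex : exists k, (k <= j) && (hgt d k <= hgt d j.+1)%R.
  by exists 0; rewrite hgt0 h0.
have ub k : (k <= j) && (hgt d k <= hgt d j.+1)%R -> k <= j by case/andP.
case: (ex_maxnP ex ub) => i /andP[le_ij le_h] maxi; exists i.
have h2 k : i < k <= j -> (hgt d j.+1 < hgt d k)%R.
  by move=> k_ij; rewrite ltNge; apply/negP=> h; have := maxi k; rewrite h; lia.
have h3 := hgtS d j; rewrite lt_j (negbTE down_j) in h3.
have ltij : i < j.
  by rewrite ltn_neqAle le_ij andbT; apply/eqP => eq_ij; subst j; lia.
have hi : hgt d j.+1 = hgt d i.
  by have := h2 i.+1; have := hgtS d i; case: ifP => _; try case: nth; lia.
by apply/matchedP; split=> // k /h2; rewrite hi.
Qed.

Lemma linked_exists d i : dyck d -> i < size d -> exists2 j, j < size d & linked d i j.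
Proof.
move=> dd lt_i; case up_i: (nth false d i).
  case: (matched_exists dd lt_i up_i) => j m; exists j; rewrite /linked ?m //.
  by case: (matched_letters m).
case: (matched_exists_down dd lt_i (negbT up_i)) => j m; exists j.
  by case/matchedP: m; lia.
by rewrite /linked m orbT.
Qed.

(* Renumbers the letters when a factor of length [q] is inserted at position [p]. *)
Definition skip_block (p q i : nat) := if i < p then i else i + q.

(** * Insertion of a Dyck factor into a word *)

Section Insertion.
Variables pre v post : seq bool.
Hypothesis dyck_v : dyck v.

Let p := size pre.
Let q := size v.

Lemma hgt_insert_left k : k <= p -> hgt (pre ++ v ++ post) k = hgt (pre ++ post) k.
Proof. by move=> le_k; rewrite !hgt_cat (eqP le_k) sub0n !hgt0. Qed.

Lemma hgt_insert_mid k : k <= q ->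
  hgt (pre ++ v ++ post) (p + k) = (hgt (pre ++ post) p + hgt v k)%R.
Proof.
move=> le_k; rewrite !hgt_cat addKn (eqP le_k) subnn !hgt0 !addr0.
by rewrite (hgt_oversize (leq_addr _ _)).
Qed.

Lemma hgt_insert_right k : p <= k ->
  hgt (pre ++ v ++ post) (k + q) = hgt (pre ++ post) k.
Proof.
move=> le_k; have /dyckP[_ h1] := dyck_v.
rewrite !hgt_cat (_ : (k + q - size pre - size v) = k - size pre); last by lia.
rewrite !(@hgt_oversize pre) ?(leq_trans le_k) ?leq_addr //.
by rewrite (@hgt_oversize v) ?h1 ?add0r // /q; lia.
Qed.

Lemma hgt_skip k : hgt (pre ++ v ++ post) (skip_block p q k) = hgt (pre ++ post) k.
Proof.
rewrite /skip_block; case: ltnP => lt_k; first exact/hgt_insert_left/ltnW.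
exact: hgt_insert_right.
Qed.

Lemma hgt_skipS k :
  hgt (pre ++ v ++ post) (skip_block p q k).+1 = hgt (pre ++ post) k.+1.
Proof.
rewrite /skip_block; case: ltnP => lt_k; first exact: hgt_insert_left.
by rewrite -addSn hgt_insert_right // ltnW.
Qed.

(** An arch passing over the inserted block has its opening height strictly below the height at [p],
    and the block never descends below that height. *)
Lemma matched_skip i j :
  matched (pre ++ v ++ post) (skip_block p q i) (skip_block p q j) =
  matched (pre ++ post) i j.
Proof.
have [hv0 hv1] := dyckP _ dyck_v.
apply/matchedP/matchedP; rewrite hgt_skip hgt_skipS => -[ltij eqh allh].
  split=> // [|k k_ij]; first by move: ltij; rewrite /skip_block; do 2!case: ifP; lia.
  rewrite -(hgt_skip k); apply: allh.
  by move: ltij; rewrite /skip_block; do 3!case: ifP; lia.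
split=> // [|k k_ij]; first by move: ltij; rewrite /skip_block; do 2!case: ifP; lia.
have [le_kp|lt_pk] := leqP k p.
  rewrite hgt_insert_left //; apply: allh.
  by move: k_ij; rewrite /skip_block; do 2!case: ifP; lia.
have [le_kq|lt_qk] := leqP k (p + q).
  rewrite -(subnKC (ltnW lt_pk)) hgt_insert_mid; last by lia.
  have : (hgt (pre ++ post) i < hgt (pre ++ post) p)%R.
    by apply: allh; move: k_ij; rewrite /skip_block; do 2!case: ifP; lia.
  by have := hv0 (k - p); lia.
rewrite -(@subnK q k); last by lia.
rewrite hgt_insert_right; last by lia.
by apply: allh; move: k_ij; rewrite /skip_block; do 2!case: ifP; lia.
Qed.

Lemma matched_block i j : i < q -> j < q ->
  matched (pre ++ v ++ post) (p + i) (p + j) = matched v i j.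
Proof.
move=> lt_i lt_j; apply/matchedP/matchedP.
  rewrite -!addnS !hgt_insert_mid ?(ltnW lt_i) // => -[ltij eqh allh].
  split=> [||k k_ij]; [lia | lia |].
  by have := allh (p + k); rewrite hgt_insert_mid; lia.
move=> [ltij eqh allh]; rewrite -!addnS !hgt_insert_mid ?(ltnW lt_i) //.
split=> [||k k_ij]; [lia | lia |].
rewrite -(@subnKC p k) ?hgt_insert_mid; try lia.
by have := allh (k - p); lia.
Qed.

(** Both ends of the block are at its minimal height, whereas an arch leaving or entering the block
    would have to stay strictly above its own level there. *)
Lemma linked_block_skip i j : i < q ->
  linked (pre ++ v ++ post) (p + i) (skip_block p q j) = false.
Proof.
have [hv0 hv1] := dyckP _ dyck_v.
move=> lt_i; apply/norP; split; apply/matchedP => -[ltij eqh allh].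
  have := allh (p + q); rewrite !hgt_insert_mid ?(ltnW lt_i) // -/q hv1.
  by have := hv0 i; move: ltij; rewrite /skip_block; case: ifP; lia.
have hp := hgt_insert_mid (leq0n q); rewrite addn0 hgt0 addr0 in hp.
rewrite -addnS hgt_insert_mid // in eqh; have := allh p; rewrite hp.
by have := hv0 i.+1; move: ltij eqh; rewrite /skip_block; case: ifP; lia.
Qed.

End Insertion.

(** * Loops of a word *)

(** The pairs of an index and a root inject into [T]: the point [f i x] determines the root [x] of
    its component, and then [i]. So every component has at least [k] points. *)
Lemma leq_mul_n_comp (T : finType) (e : rel T) k (f : 'I_k -> T -> T) :
    connect_sym e -> (forall i x, connect e x (f i x)) ->
    (forall x, injective (f^~ x)) ->
  k * n_comp e T <= #|T|.
Proof.
move=> sym_e conn_f inj_f.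
have -> : n_comp e T = #|[set x | roots e x]|.
  by rewrite /n_comp_mem; apply: eq_card => x; rewrite !inE andbT.
have <- : #|setX [set: 'I_k] [set x | roots e x]| = k * #|[set x | roots e x]|.
  by rewrite cardsX cardsT card_ord.
rewrite -(card_in_imset (f := fun u => f u.1 u.2)) ?max_card //.
move=> [i x] [j y] /setXP[_ +] /setXP[_ +]; rewrite !inE /= => /eqP rx /eqP ry eq_f.
have eq_xy : x = y.
  rewrite -{1}rx -{1}ry; apply/(fingraph.rootP sym_e)/(connect_trans (conn_f i x)).
  by rewrite eq_f sym_e.
by congr (_, _) => //; apply: (inj_f x); rewrite eq_f eq_xy.
Qed.

(* The two coordinates of a letter record, for the upper and for the lower
   pairing, whether a point opens an arch. *)
Local Notation letter := (bool * bool)%type.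

Section Loops.
Implicit Types w v pre post : seq letter.

Definition system w := dyck (unzip1 w) && dyck (unzip2 w).

Definition wedge w (i j : nat) := linked (unzip1 w) i j || linked (unzip2 w) i j.

Definition nloops w := n_comp (fun i j : 'I_(size w) => wedge w i j) 'I_(size w).

Lemma wedge_connect_sym w n : connect_sym (fun i j : 'I_n => wedge w i j).
Proof. by apply: sym_connect_sym => x y; rewrite /wedge !(linkedC _ x). Qed.

Lemma unzip1_cat v w : unzip1 (v ++ w) = unzip1 v ++ unzip1 w.
Proof. exact: map_cat. Qed.
Lemma unzip2_cat v w : unzip2 (v ++ w) = unzip2 v ++ unzip2 w.
Proof. exact: map_cat. Qed.

Lemma nloops_insert pre v post : system v ->
  nloops (pre ++ v ++ post) = nloops v + nloops (pre ++ post).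
Proof.
case/andP=> dyck1 dyck2; set w := pre ++ v ++ post.
pose p := size pre; pose q := size v.
have sw : size w = p + (q + size post) by rewrite !size_cat.
have sr : size (pre ++ post) = p + size post by rewrite size_cat.
have block i j : i < q -> j < q -> wedge w (p + i) (p + j) = wedge v i j.
  move=> lt_i lt_j; rewrite /wedge /linked !unzip1_cat !unzip2_cat.
  have h1 := @matched_block (unzip1 pre) (unzip1 v) (unzip1 post).
  have h2 := @matched_block (unzip2 pre) (unzip2 v) (unzip2 post).
  by rewrite !size_map in h1 h2; rewrite !h1 // !h2.
have rest i j : wedge w (skip_block p q i) (skip_block p q j) =
                wedge (pre ++ post) i j.
  rewrite /wedge /linked !unzip1_cat !unzip2_cat.
  have h1 := matched_skip (unzip1 pre) (unzip1 post) dyck1.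
  have h2 := matched_skip (unzip2 pre) (unzip2 post) dyck2.
  by rewrite !size_map in h1 h2; rewrite !h1 !h2.
have cross i j : i < q -> wedge w (p + i) (skip_block p q j) = false.
  move=> lt_i; rewrite /wedge !unzip1_cat !unzip2_cat.
  have h1 := linked_block_skip (unzip1 pre) (unzip1 post) dyck1.
  have h2 := linked_block_skip (unzip2 pre) (unzip2 post) dyck2.
  by rewrite !size_map in h1 h2; rewrite h1 ?h2.
have skipE i : ~~ (p <= i < p + q) ->
    skip_block p q (if i < p then i else i - q) = i.
  by rewrite /skip_block; case: ifP; case: ifP; lia.
(* The block is a union of components. Components inside and outside it are counted separately, each
   side being a relabelled copy of a smaller graph. *)
pose a := [pred i : 'I_(size w) | p <= i < p + q].
pose e (i j : 'I_(size w)) := wedge w i j.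
have sym_e : connect_sym e := @wedge_connect_sym _ _.
have closed_a : closed e a.
  apply: intro_closed => // i j e_ij a_i; apply: contraLR e_ij => a_j.
  rewrite /e -(skipE j a_j) -(subnKC (proj1 (andP a_i))) cross //.
  by move/andP: a_i; lia.
rewrite /nloops (n_compC a); congr (_ + _).
  have lt_h (i : 'I_(size v)) : p + i < size w by rewrite sw; have := ltn_ord i; lia.
  pose h i := Ordinal (lt_h i).
  have inj_h : injective h.
    by move=> i j /(congr1 val) /= /addnI eq_ij; apply: val_inj.
  have a_h : a \subset codom h.
    apply/subsetP => i /andP[le_i lt_i]; have lt_i' : i - p < size v by rewrite -/q; lia.
    by apply/codomP; exists (Ordinal lt_i'); apply: val_inj; rewrite /= subnKC.
  rewrite (adjunction_n_comp h sym_e (@wedge_connect_sym v _) closed_a).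
    by apply: eq_n_comp_r => i; rewrite !inE /= leq_addr ltn_add2l ltn_ord.
  apply: strict_adjunction => //; first exact: wedge_connect_sym.
  by move=> i j _; apply: block.
have lt_h (i : 'I_(size (pre ++ post))) : skip_block p q i < size w.
  by have := ltn_ord i; rewrite [X in _ < X]sr sw /skip_block; case: ifP; lia.
pose h i := Ordinal (lt_h i).
have inj_h : injective h.
  move=> i j /(congr1 val) /= eq_ij; apply: val_inj; move: eq_ij.
  by rewrite /skip_block /=; do 2!case: ifP; lia.
have a_h : [predC a] \subset codom h.
  apply/subsetP => i a_i.
  have lt_i : (if i < p then nat_of_ord i else i - q) < size (pre ++ post).
    move: a_i; have := ltn_ord i; rewrite !inE [X in _ < X]sw [X in _ -> _ < X]sr.
    by case: ifP; lia.
  by apply/codomP; exists (Ordinal lt_i); apply: val_inj; rewrite /= skipE.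
have closed_Ca : closed e [predC a] by move=> i j /closed_a; rewrite !inE => ->.
rewrite (adjunction_n_comp h sym_e (@wedge_connect_sym (pre ++ post) _) closed_Ca).
  apply: eq_n_comp_r => i; rewrite !inE /= /skip_block; case: ifP; lia.
apply: strict_adjunction => //; first exact: wedge_connect_sym.
by move=> i j _; apply: rest.
Qed.

Lemma wedge_partners w : system w ->
  exists f g : 'I_(size w) -> 'I_(size w),
    (forall i : 'I_(size w), linked (unzip1 w) i (f i)) /\
    (forall i : 'I_(size w), linked (unzip2 w) i (g i)).
Proof.
case/andP=> d1 d2.
have ex1 (i : 'I_(size w)) : exists j : 'I_(size w), linked (unzip1 w) i j.
  have lt_i : i < size (unzip1 w) by rewrite size_map.
  have [j] := linked_exists d1 lt_i; rewrite size_map => lt_j ij.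
  by exists (Ordinal lt_j).
have ex2 (i : 'I_(size w)) : exists j : 'I_(size w), linked (unzip2 w) i j.
  have lt_i : i < size (unzip2 w) by rewrite size_map.
  have [j] := linked_exists d2 lt_i; rewrite size_map => lt_j ij.
  by exists (Ordinal lt_j).
have [f Pf] := fin_all_exists ex1; have [g Pg] := fin_all_exists ex2.
by exists f, g.
Qed.

(** Every loop contains a point and its upper partner. *)
Lemma nloops_le w : system w -> 2 * nloops w <= size w.
Proof.
move=> /wedge_partners[f [g [Pf _]]].
rewrite -[leqRHS]card_ord.
apply: (leq_mul_n_comp (f := fun (k : 'I_2) i => nth i [:: i; f i] k)).
- exact: wedge_connect_sym.
- by move=> [[|[|k]] ltk] i //=; apply: connect1; rewrite /wedge Pf.
move=> i j k /eqP; rewrite nth_uniq //; first by move/eqP/val_inj.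
rewrite /= inE andbT; apply/eqP => eq_i.
by have := Pf i; rewrite -eq_i linked_irr.
Qed.

(** Without circles the two partner involutions [f] and [g] disagree at every point, so i, f i, g i
    and g (f i) are four distinct points of one loop. *)
Lemma nloops_circle_free w : system w ->
    (forall i j, matched (unzip1 w) i j -> matched (unzip2 w) i j -> False) ->
  4 * nloops w <= size w.
Proof.
move=> /wedge_partners[f [g [Pf Pg]]] nocirc.
have fg i : f i != g i.
  apply/eqP=> eq_fg; have := Pf i; have := Pg i; rewrite -eq_fg.
  case/orP=> m2 /orP[] m1.
  - exact: nocirc m1 m2.
  - by case/matchedP: m1; case/matchedP: m2; lia.
  - by case/matchedP: m1; case/matchedP: m2; lia.
  - exact: nocirc m1 m2.
have f_neq i : i != f i by apply/eqP=> eq_i; have := Pf i; rewrite -eq_i linked_irr.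
have g_neq i : i != g i by apply/eqP=> eq_i; have := Pg i; rewrite -eq_i linked_irr.
have fK i : f (f i) = i.
  by apply/val_inj/(linked_fun (Pf (f i))); rewrite linkedC; apply: Pf.
have gK i : g (g i) = i.
  by apply/val_inj/(linked_fun (Pg (g i))); rewrite linkedC; apply: Pg.
rewrite -[leqRHS]card_ord.
pose orb i := [:: i; f i; g i; g (f i)].
apply: (leq_mul_n_comp (f := fun (k : 'I_4) i => nth i (orb i) k)).
- exact: wedge_connect_sym.
- have c1 i : connect (fun i j : 'I_(size w) => wedge w i j) i (f i).
    by apply: connect1; rewrite /wedge Pf.
  have c2 i : connect (fun i j : 'I_(size w) => wedge w i j) i (g i).
    by apply: connect1; rewrite /wedge Pg orbT.
  by move=> [[|[|[|[|k]]]] ltk] i //=; apply: connect_trans (c1 i) (c2 _).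
move=> i j k /eqP; rewrite nth_uniq //; first by move/eqP/val_inj.
rewrite /= !inE !negb_or f_neq g_neq fg g_neq /= !andbT; apply/andP; split.
  by apply: contra (fg i) => /eqP eq_i; rewrite {2}eq_i gK.
by apply: contra (f_neq i) => /eqP /(congr1 g); rewrite !gK => {1}->.
Qed.

Lemma nloops_gt0 w : 0 < size w -> 0 < nloops w.
Proof.
move=> w_gt0; pose e (i j : 'I_(size w)) := wedge w i j.
apply/card_gt0P; exists (fingraph.root e (Ordinal w_gt0)).
by rewrite !inE andbT; apply: roots_root; apply: wedge_connect_sym.
Qed.

(** Two insertions: [v] into the one-loop system [[:: a; b]], then the result into the surrounding
    word. *)
Lemma nloops_circle pre v post : system v ->
  nloops (pre ++ (true, true) :: v ++ (false, false) :: post) =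
  (nloops v).+1 + nloops (pre ++ post).
Proof.
move=> sys_v; set a := (true, true); set b := (false, false).
have sys_ab : system [:: a; b] by [].
have ab : nloops [:: a; b] = 1.
  by apply/eqP; rewrite eqn_leq nloops_gt0 // -(leq_pmul2l (ltn0Sn 1)) nloops_le.
have sys_avb : system (a :: v ++ [:: b]).
  case/andP: sys_v => d1 d2; rewrite /system /= unzip1_cat unzip2_cat.
  by rewrite !(dyck_from_cat 1) ?(dyck_from_cat 0).
have -> : a :: v ++ b :: post = (a :: v ++ [:: b]) ++ post by rewrite /= -catA.
rewrite nloops_insert // -cat1s (nloops_insert [:: a] [:: b] sys_v) /= ab.
by rewrite addn1.
Qed.

End Loops.

(** * Non-crossing pairings as Dyck words *)

Definition arcs (m : nat) (d : seq bool) : {set {set 'I_m}} :=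
  [set [set u.1; u.2] | u in [pred u : 'I_m * 'I_m | matched d u.1 u.2]].

Lemma eq_set2 (T : finType) (i j k l : T) : [set i; j] = [set k; l] ->
  (i = k /\ j = l) \/ (i = l /\ j = k).
Proof.
move=> eq_s; have := set21 i j; have := set22 i j; rewrite eq_s => /set2P hj /set2P hi.
have := set21 k l; have := set22 k l; rewrite -eq_s => /set2P hl /set2P hk.
by case: hi hj hk hl => hi [] hj [] hk [] hl;
  (left; split; congruence) || (right; split; congruence).
Qed.

Lemma mem_arcs m d (i j : 'I_m) : ([set i; j] \in arcs m d) = linked d i j.
Proof.
apply/imsetP/orP => [[[k l] /= m_kl /eq_set2[] [-> ->]]|[m_ij|m_ij]]; auto.
  by exists (i, j).
by exists (j, i); rewrite // setUC.
Qed.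

Lemma arcs_block m d B (i : 'I_m) : B \in arcs m d -> i \in B ->
  exists2 j, B = [set i; j] & linked d i j.
Proof.
case/imsetP=> -[k l]; rewrite inE /= => m_kl -> /set2P[->|->].
  by exists l; rewrite // /linked m_kl.
by exists k; [rewrite setUC | rewrite /linked m_kl orbT].
Qed.

Lemma arcs_NC2 m d : dyck d -> size d = m -> arcs m d \in NC2 m.
Proof.
move=> dd sd; rewrite inE; apply/andP; split.
  apply/andP; split; last first.
    apply/forall_inP => B /imsetP[[k l]]; rewrite inE /= => m_kl ->.
    rewrite cards2; have [eq_kl|//] := eqVneq k l.
    by move: m_kl; rewrite eq_kl /matched ltnn.
  apply/and3P; split.
  - apply/eqP/setP => i; rewrite inE; apply/bigcupP.
    have lt_i : i < size d by rewrite sd.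
    have [j lt_j ij] := linked_exists dd lt_i; rewrite sd in lt_j.
    exists [set i; Ordinal lt_j]; last exact: set21.
    by rewrite mem_arcs.
  - apply/trivIsetP => A B arcA arcB; apply: contraR => /pred0Pn[i /andP[iA iB]].
    have [j -> ij] := arcs_block arcA iA; have [k -> ik] := arcs_block arcB iB.
    by rewrite (val_inj (linked_fun ij ik)).
  - apply/negP => /imsetP[[k l] _ /= e0]; have := set21 k l.
    by rewrite -e0 inE.
apply/existsP => -[a /existsP[b /existsP[c /existsP[e /and5P[ab ce ac cb be]]]]].
move: ab ce; rewrite !mem_arcs /linked.
case/orP=> /matchedP[h1 h2 h3]; last by lia.
case/orP=> /matchedP[h1' h2' h3']; last by lia.
(* Crossing arcs would give [hgt d a < hgt d c] and [hgt d c < hgt d b.+1], although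
   [hgt d b.+1 = hgt d a]. *)
by have := h3 c; have := h3' b.+1; lia.
Qed.

Lemma arcs_inj m d d' : dyck d -> dyck d' -> size d = m -> size d' = m ->
  arcs m d = arcs m d' -> d = d'.
Proof.
move=> dd dd' sd sd' eq_a; apply: (@eq_from_nth _ false) => [|i lt_i].
  by rewrite sd sd'.
have [j lt_j ij] := linked_exists dd lt_i; rewrite sd in lt_i lt_j.
have := mem_arcs d (Ordinal lt_i) (Ordinal lt_j); rewrite eq_a mem_arcs ij /=.
case/orP: ij => m1 /orP[] m2.
- by have [_ -> _] := matched_letters m1; have [_ -> _] := matched_letters m2.
- by case/matchedP: m1; case/matchedP: m2; lia.
- by case/matchedP: m1; case/matchedP: m2; lia.
- have [_ _ /negbTE->] := matched_letters m1.
  by have [_ _ /negbTE->] := matched_letters m2.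
Qed.

(** * The Dyck word of a non-crossing involution *)

Section WordOfPairing.
Variables (m : nat) (p : 'I_m -> 'I_m).
Hypothesis pK : involutive p.
Hypothesis p_neq : forall i, p i != i.
Hypothesis p_nc : forall a c : 'I_m, ~~ [&& a < c, c < p a & p a < p c].

Let s (i : 'I_m) : int := if i < p i then 1%R else (-1)%R.

Let d : seq bool := [seq nat_of_ord i < p i | i : 'I_m].

Let size_d : size d = m. Proof. by rewrite size_map size_enum_ord. Qed.

Let nth_d (i : 'I_m) : nth false d i = (i < p i).
Proof. by rewrite (nth_map i) ?size_enum_ord // nth_ord_enum. Qed.

Let s_p i : s (p i) = (- s i)%R.
Proof.
have := p_neq i; rewrite /s pK -val_eqE /=.
by case: ltngtP; rewrite ?opprK.
Qed.

Let hgt_d k : k <= m -> hgt d k = (\sum_(i < m | (i < k)%N) s i)%R.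
Proof.
elim: k => [|k IHk] lt_k; first by rewrite hgt0 big_pred0.
rewrite hgtS size_d lt_k IHk 1?ltnW // (nth_d (Ordinal lt_k)).
rewrite [RHS](bigD1 (Ordinal lt_k)) //= addrC; congr (_ + _)%R.
by apply: eq_bigl => i; rewrite ltnS ltn_neqAle andbC.
Qed.

Let hgt_dB k l : k <= l <= m ->
  hgt d l = (hgt d k + \sum_(i < m | (k <= i < l)%N) s i)%R.
Proof.
move=> /andP[le_kl le_lm]; rewrite !hgt_d ?(leq_trans le_kl) //.
rewrite (bigID [pred i : 'I_m | i < k]) /=; congr (_ + _)%R; apply: eq_bigl => i; lia.
Qed.

Let sum_closed (I : pred 'I_m) : (forall i, I i -> I (p i)) ->
  (\sum_(i | I i) s i = 0)%R.
Proof.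
move=> clI; suff : (\sum_(i | I i) s i = - \sum_(i | I i) s i)%R by lia.
rewrite {1}(reindex_inj (inv_inj pK)) /= -sumrN; apply: eq_big => i.
  by apply/idP/idP => /clI //; rewrite pK.
by move=> _; apply: s_p.
Qed.

(** Pairs lying inside [I] cancel. By hypothesis no closing point of [I] has its partner outside, so
    only opening points remain. *)
Let sum_ge0 (I : pred 'I_m) : (forall i, I i -> p i < i -> I (p i)) ->
  (0 <= \sum_(i | I i) s i)%R.
Proof.
move=> clI; rewrite (bigID [pred i | I (p i)]) /= sum_closed ?add0r; last first.
  by move=> i; rewrite pK andbC.
apply: sumr_ge0 => i /andP[Ii nIp]; rewrite /s.
have := p_neq i; rewrite -val_eqE /=.
by case: ltngtP => // /(clI _ Ii); rewrite (negbTE nIp).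
Qed.

Let dyck_d : dyck d.
Proof.
have h0 : hgt d m = 0%R by rewrite hgt_d ?sum_closed.
apply/dyckP; rewrite size_d; split=> // k.
have [le_km|lt_mk] := leqP k m; last by rewrite hgt_oversize ?size_d ?h0 // ltnW.
by rewrite hgt_d //; apply: sum_ge0 => i; lia.
Qed.

Let matched_d (a : 'I_m) : a < p a -> matched d a (p a).
Proof.
move=> lt_a; have lt_pa := ltn_ord (p a); apply/matchedP; split=> // [|k k_ij].
  (* Non-crossing makes the interval from [a] to [p a] stable under [p], so its signs cancel. *)
  rewrite (@hgt_dB a (p a).+1) ?sum_closed ?addr0; try lia.
  move=> i i_a; have := p_nc a i; have := p_nc (p i) a; rewrite pK.
  have [->|i_neq_a] := eqVneq i a; first by lia.
  have [eq_i|i_neq_pa] := eqVneq i (p a); first by rewrite eq_i pK; lia.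
  by move: i_neq_a i_neq_pa; rewrite -!val_eqE /=; lia.
rewrite (@hgt_dB a k); last by lia.
(* The point [a] contributes 1. The remaining points before [k] contribute a non-negative amount,
   since a closing point among them has its opening point after [a]. *)
rewrite (bigD1 a) /=; last by lia.
rewrite {1}/s lt_a.
set S := (\sum_(_ | _) _)%R; suff : (0 <= S)%R by lia.
apply: sum_ge0 => i; rewrite -!val_eqE /= => i_ak lt_i.
have := p_nc (p i) a; rewrite pK.
have [eq_pi|] := eqVneq (p i) a; first by move: i_ak; rewrite -(pK i) eq_pi; lia.
by rewrite -val_eqE /=; lia.
Qed.

Lemma word_of_pairing : exists d : seq bool,
  [/\ size d = m, dyck d & forall i : 'I_m, linked d i (p i)].
Proof.
exists d; split=> // i; have := p_neq i; rewrite -val_eqE /= /linked.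
case: ltngtP => // lt_i _; last by rewrite matched_d.
by have := matched_d (a := p i); rewrite pK => ->; rewrite ?orbT.
Qed.

End WordOfPairing.

Lemma NC2_arcs m P : P \in NC2 m ->
  exists d, [/\ size d = m, dyck d & arcs m d = P].
Proof.
rewrite inE => /andP[/andP[/and3P[/eqP covP tiP n0P] /forall_inP cardP] ncP].
have ex_p (i : 'I_m) : exists j : 'I_m, (j != i) && ([set i; j] \in P).
  have : i \in cover P by rewrite covP inE.
  case/bigcupP=> B BP iB; have /cards2P[x [y [neq_xy eq_B]]] := cardP B BP.
  move: iB BP; rewrite eq_B => /set2P[->|->] BP; first by exists y; rewrite eq_sym neq_xy.
  by exists x; rewrite neq_xy setUC.
have {ex_p} [p Pp] := fin_all_exists ex_p.
have p_neq i : p i != i by case/andP: (Pp i).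
have p_in i : [set i; p i] \in P by case/andP: (Pp i).
have p_uniq i j : [set i; j] \in P -> j = p i.
  move=> ijP; have := set22 i (p i).
  rewrite -(def_pblock tiP (p_in i) (set21 _ _)) (def_pblock tiP ijP (set21 _ _)).
  by case/set2P=> // eq_p; have := p_neq i; rewrite eq_p eqxx.
have pK : involutive p by move=> i; apply/esym/p_uniq; rewrite setUC.
have p_nc (a c : 'I_m) : ~~ [&& a < c, c < p a & p a < p c].
  apply/negP=> /and3P[h1 h2 h3]; case/negP: ncP.
  apply/existsP; exists a; apply/existsP; exists (p a).
  apply/existsP; exists c; apply/existsP; exists (p c).
  by rewrite !p_in h1 h2 h3.
have [d [sd dd pd]] := word_of_pairing pK p_neq p_nc.
exists d; split=> //; apply/setP => B; apply/idP/idP => [/imsetP[[i j]]|BP].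
  rewrite inE /= => m_ij ->; have ij : linked d i j by rewrite /linked m_ij.
  by rewrite (val_inj (linked_fun ij (pd i))) p_in.
have /cards2P[x [y [_ eq_B]]] := cardP B BP; rewrite eq_B in BP *.
by rewrite mem_arcs (p_uniq _ _ BP).
Qed.

Lemma loops_arcs m (w : seq letter) : size w = m ->
  loops (arcs m (unzip1 w)) (arcs m (unzip2 w)) = nloops w.
Proof.
move=> <-; apply: eq_n_comp; apply: eq_connect => i j.
by rewrite /meander_edge !mem_arcs.
Qed.

(** [arcs] is a bijection from Dyck words onto non-crossing pairings; zipping two such words encodes
    a pair of pairings by a single word. *)
Lemma meandric_numberE n k :
  meandric_number n k =
  #|[set w : (2 * n).-tuple letter | system w && (nloops w == k)]|.
Proof.
pose F (w : (2 * n).-tuple letter) := (arcs (2 * n) (unzip1 w), arcs (2 * n) (unzip2 w)).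
rewrite -(@card_in_imset _ _ F); last first.
  move=> w w'; rewrite !inE => /andP[/andP[d1 d2] _] /andP[/andP[d1' d2'] _] [e1 e2].
  have s1 (u : (2 * n).-tuple letter) : size (unzip1 u) = 2 * n by rewrite size_map size_tuple.
  have s2 (u : (2 * n).-tuple letter) : size (unzip2 u) = 2 * n by rewrite size_map size_tuple.
  apply: val_inj; rewrite /= -[LHS]zip_unzip -[RHS]zip_unzip.
  by rewrite (arcs_inj d1 d1' _ _ e1) // (arcs_inj d2 d2' _ _ e2).
apply: eq_card => -[P Q]; rewrite inE /=; apply/andP/imsetP => /=.
  case=> /setXP[/NC2_arcs[d [sd dd <-]] /NC2_arcs[e [se de <-]]].
  have s_w : size (zip d e) == 2 * n by rewrite size_zip sd se minnn.
  have u1 : unzip1 (zip d e) = d by rewrite unzip1_zip // sd se.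
  have u2 : unzip2 (zip d e) = e by rewrite unzip2_zip // sd se.
  have := loops_arcs (eqP s_w); rewrite u1 u2 => -> eq_k.
  by exists (Tuple s_w); rewrite ?inE /= /system /F /= ?u1 ?u2 ?dd ?de.
case=> w; rewrite inE => /andP[/andP[d1 d2] eq_k] [-> ->]; split.
  by rewrite inE !arcs_NC2 // size_map size_tuple.
by rewrite loops_arcs // size_tuple.
Qed.

Local Open Scope ring_scope.

(** * The ring of formal power series *)

Local Notation sX := (fps_of_poly 'X).

Section SeriesRing.
Variable R : comUnitRingType.
Implicit Types f g h : fps R.

HB.instance Definition _ := gen_eqMixin (fps R).
HB.instance Definition _ := gen_choiceMixin (fps R).

Definition fps_add f g : fps R := fun n => f n + g n.
Definition fps_opp f : fps R := fun n => - f n.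
Definition fps_zero : fps R := fun=> 0.

Fact fps_addA : associative fps_add.
Proof. by move=> f g h; apply/funext => n; apply: addrA. Qed.
Fact fps_addC : commutative fps_add.
Proof. by move=> f g; apply/funext => n; apply: addrC. Qed.
Fact fps_add0 : left_id fps_zero fps_add.
Proof. by move=> f; apply/funext => n; apply: add0r. Qed.
Fact fps_addN : left_inverse fps_zero fps_opp fps_add.
Proof. by move=> f; apply/funext => n; apply: addNr. Qed.

HB.instance Definition _ :=
  GRing.isZmodule.Build (fps R) fps_addA fps_addC fps_add0 fps_addN.

(** Reduces the ring laws for series to those of polynomials, one coefficient at a time. *)
Lemma fps_mul_trunc N f g n : (n < N)%N ->
  fps_mul f g n = ((\poly_(i < N) f i) * (\poly_(i < N) g i))`_n.
Proof.
move=> lt_nN; rewrite coefM; apply: eq_bigr => i _; rewrite !coef_poly.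
by rewrite (leq_ltn_trans (leq_subr _ _) lt_nN) (leq_ltn_trans _ lt_nN) // -ltnS.
Qed.

Fact fps_mulC : commutative (@fps_mul R).
Proof.
by move=> f g; apply/funext => n; rewrite !(@fps_mul_trunc n.+1) // mulrC.
Qed.

Fact fps_mulA : associative (@fps_mul R).
Proof.
move=> f g h; apply/funext => n; pose t (f : fps R) := \poly_(i < n.+1) f i.
transitivity ((t f * (t g * t h))`_n).
  rewrite coefM; apply: eq_bigr => i _; rewrite coef_poly ltn_ord.
  by rewrite (@fps_mul_trunc n.+1) ?ltnS ?leq_subr.
rewrite mulrA coefM; apply: eq_bigr => i _.
by rewrite coef_poly ltnS leq_subr (@fps_mul_trunc n.+1).
Qed.

Fact fps_mul1 : left_id (@fps_one R) (@fps_mul R).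
Proof.
move=> f; apply/funext => n; rewrite /fps_mul big_ord_recl mul1r subn0.
by rewrite big1 ?addr0 // => i _; rewrite mul0r.
Qed.

Fact fps_mulDl : left_distributive (@fps_mul R) fps_add.
Proof.
move=> f g h; apply/funext => n; rewrite /fps_add /fps_mul -big_split.
by apply: eq_bigr => i _; rewrite mulrDl.
Qed.

Fact fps_one_neq0 : @fps_one R != 0.
Proof.
by apply/eqP => /(congr1 (fun f => f 0%N)) /eqP; rewrite /fps_one oner_eq0.
Qed.

HB.instance Definition _ := GRing.Zmodule_isComNzRing.Build (fps R)
  fps_mulA fps_mulC fps_mul1 fps_mulDl fps_one_neq0.

Lemma coefsD f g n : (f + g) n = f n + g n. Proof. by []. Qed.
Lemma coefsB f g n : (f - g) n = f n - g n. Proof. by []. Qed.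
Lemma coefs1 n : (1 : fps R) n = (n == 0)%N%:R. Proof. by []. Qed.
Lemma coefsM f g n : (f * g) n = \sum_(i < n.+1) f i * g (n - i)%N.
Proof. by []. Qed.

Lemma coefs_sum I (r : seq I) (P : pred I) (F : I -> fps R) n :
  (\sum_(i <- r | P i) F i) n = \sum_(i <- r | P i) F i n.
Proof. by apply: (big_morph (fun f : fps R => f n)). Qed.

Lemma fps_expE f n : fps_exp f n = f ^+ n.
Proof. by elim: n => // n; rewrite exprS => <-. Qed.

Lemma fps_divE f g : fps_div f g = f * fps_inv g.
Proof. by []. Qed.

Lemma fps_mulVr f : f 0%N \is a GRing.unit -> f * fps_inv f = 1.
Proof. by move=> f0; apply/funext; apply: fps_mulV. Qed.

Lemma fps_unit_inj f g h : f 0%N \is a GRing.unit -> f * g = f * h -> g = h.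
Proof.
move=> /fps_mulVr fV /(congr1 ( *%R (fps_inv f))).
by rewrite !mulrA [fps_inv f * f]mulrC fV !mul1r.
Qed.

(** The unit ring structure lets the construction be nested: the coefficients of [fps (fps rat)]
    must themselves form a [comUnitRingType]. *)
Definition fps_unit : pred (fps R) := fun f => f 0%N \is a GRing.unit.
Definition fps_invr f : fps R := if fps_unit f then fps_inv f else f.

Fact fps_mulVx : {in fps_unit, left_inverse 1 fps_invr *%R}.
Proof. by move=> f uf; rewrite mulrC /fps_invr (uf : fps_unit f) fps_mulVr. Qed.

Fact fps_unitPl f g : g * f = 1 -> fps_unit f.
Proof.
move=> /(congr1 (fun h : fps R => h 0%N)); rewrite mulrC coefsM big_ord1 => fg.
by apply/unitrPr; exists (g 0%N).
Qed.

Fact fps_invr_out : {in [predC fps_unit], fps_invr =1 id}.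
Proof. by move=> f /negbTE uf; rewrite /fps_invr [fps_unit f]uf. Qed.

HB.instance Definition _ := GRing.ComNzRing_hasMulInverse.Build (fps R)
  fps_mulVx fps_unitPl fps_invr_out.

Fact fps_of_poly_is_zmod_morphism : zmod_morphism (@fps_of_poly R).
Proof. by move=> p q; apply/funext => n; apply: coefB. Qed.
HB.instance Definition _ := GRing.isZmodMorphism.Build {poly R} (fps R)
  (@fps_of_poly R) fps_of_poly_is_zmod_morphism.
Fact fps_of_poly_is_monoid_morphism : monoid_morphism (@fps_of_poly R).
Proof.
split=> [|p q]; apply/funext => n; first exact: coef1.
exact: coefM.
Qed.
HB.instance Definition _ := GRing.isMonoidMorphism.Build {poly R} (fps R)
  (@fps_of_poly R) fps_of_poly_is_monoid_morphism.

Lemma coefs_expr_lt f n k : f 0%N = 0 -> (k < n)%N -> (f ^+ n) k = 0.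
Proof.
move=> f0; elim: n k => // n IHn k lt_kn; rewrite exprS coefsM big_ord_recl.
rewrite f0 mul0r add0r big1 // => i _; rewrite IHn ?mulr0 //=.
by have := ltn_ord i; rewrite /bump /=; lia.
Qed.

End SeriesRing.

Section Composition.
Variables (R : comUnitRingType) (g : fps R).
Hypothesis g0 : g 0%N = 0.
Implicit Types f h : fps R.

Definition fps_const : R -> fps R := @fps_of_poly R \o polyC.
HB.instance Definition _ := GRing.RMorphism.on fps_const.

Lemma coefs_constM a f n : (fps_const a * f) n = a * f n.
Proof.
rewrite coefsM big_ord_recl subn0 big1 ?addr0 => [|i _].
  by congr (_ * _); apply: coefC.
by rewrite [fps_const a _]coefC mul0r.
Qed.

(** Up to any given degree, composing with [g] is the evaluation at [g] of a truncation.
    Multiplicativity of composition then comes from that of Horner evaluation. *)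
Let ev (p : {poly R}) : fps R := (map_poly fps_const p).[g].

Let evE p k : ev p k = \sum_(i < k.+1) p`_i * (g ^+ i) k.
Proof.
rewrite /ev (@horner_coef_wide _ (maxn (size p) k.+1)); last first.
  by rewrite (leq_trans (size_poly _ _)) ?leq_maxl.
rewrite coefs_sum (big_ord_widen (maxn (size p) k.+1)
  (fun i => p`_i * (g ^+ i) k)) ?leq_maxr // [RHS]big_mkcond.
apply: eq_bigr => i _; rewrite coef_map coefs_constM.
by case: ltnP => // lt_ki; rewrite coefs_expr_lt ?mulr0.
Qed.

Let comp_ev N f k : (k < N)%N -> fps_comp f g k = ev (\poly_(i < N) f i) k.
Proof.
move=> lt_kN; rewrite evE; apply: eq_bigr => i _.
by rewrite coef_poly fps_expE (leq_trans (ltn_ord i)).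
Qed.

Lemma fps_compM f h : fps_comp (f * h) g = fps_comp f g * fps_comp h g.
Proof.
apply/funext => k; pose t (f : fps R) := \poly_(i < k.+1) f i.
transitivity ((ev (t f) * ev (t h)) k); last first.
  rewrite !coefsM; apply: eq_bigr => i _.
  by rewrite !(@comp_ev k.+1) ?ltnS ?leq_subr ?leq_ord.
rewrite /ev -hornerM -rmorphM -/(ev _) (@comp_ev k.+1) // !evE.
apply: eq_bigr => i _; congr (_ * _); rewrite coef_poly ltn_ord.
exact: fps_mul_trunc.
Qed.

Lemma fps_compB f h : fps_comp (f - h) g = fps_comp f g - fps_comp h g.
Proof.
apply/funext => k; rewrite coefsB /fps_comp -sumrB.
by apply: eq_bigr => i _; rewrite coefsB mulrBl.
Qed.

Lemma fps_compD f h : fps_comp (f + h) g = fps_comp f g + fps_comp h g.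
Proof.
apply/funext => k; rewrite coefsD /fps_comp -big_split.
by apply: eq_bigr => i _; rewrite coefsD mulrDl.
Qed.

Lemma fps_comp0 : fps_comp 0 g = 0.
Proof. by apply/funext => k; apply: big1 => i _; rewrite mul0r. Qed.

Lemma fps_comp1 : fps_comp 1 g = 1.
Proof.
apply/funext => k; rewrite /fps_comp big_ord_recl mul1r.
by rewrite big1 ?addr0 // => i _; rewrite mul0r.
Qed.

Lemma fps_compX : fps_comp (fps_of_poly 'X) g = g.
Proof.
apply/funext => -[|k].
  by rewrite /fps_comp big_ord1 g0 [fps_of_poly _ _]coefX mul0r.
rewrite /fps_comp 2!big_ord_recl big1 => [|i _].
  rewrite fps_expE ![fps_of_poly _ _]coefX mul0r mul1r add0r addr0.
  by rewrite fps_expE.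
by rewrite [fps_of_poly _ _]coefX mul0r.
Qed.

End Composition.

Section Agreement.
Variable R : comUnitRingType.
Implicit Types f g h : fps R.

Lemma coefsXM f n : (sX * f) n = if n is n'.+1 then f n' else 0.
Proof.
case: n => [|n]; first by rewrite coefsM big_ord1 [sX _]coefX mul0r.
rewrite coefsM 2!big_ord_recl [sX _]coefX mul0r add0r big1 ?addr0 => [|i _].
  by rewrite [sX _]coefX mul1r subSS subn0.
by rewrite [sX _]coefX mul0r.
Qed.

(** Congruence modulo the power N+1 of the variable; infinite sums of series are handled through
    finite sums and this relation. *)
Definition agree N f g := forall n, (n <= N)%N -> f n = g n.

Lemma agreeD N f f' g g' : agree N f g -> agree N f' g' -> agree N (f + f') (g + g').
Proof. by move=> fg fg' n le_n; rewrite !coefsD fg ?fg'. Qed.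

Lemma agree_mull N h f g : agree N f g -> agree N (h * f) (h * g).
Proof.
move=> fg n le_n; rewrite !coefsM; apply: eq_bigr => i _.
by rewrite fg // (leq_trans (leq_subr _ _)).
Qed.

Lemma agree_mulX N f g : agree N f g -> agree N.+1 (sX * f) (sX * g).
Proof. by move=> fg [|n] le_n; rewrite !coefsXM // fg. Qed.

Lemma agree_sum N I (r : seq I) (F G : I -> fps R) :
  (forall i, agree N (F i) (G i)) ->
  agree N (\sum_(i <- r) F i) (\sum_(i <- r) G i).
Proof.
by move=> FG n le_n; rewrite !coefs_sum; apply: eq_bigr => i _; apply: FG.
Qed.

Lemma fps_exprX n : sX ^+ n = fps_of_poly ('X^n) :> fps R.
Proof. by rewrite rmorphXn. Qed.

Lemma fps_comp_exp f g n : g 0%N = 0 -> fps_comp (f ^+ n) g = fps_comp f g ^+ n.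
Proof.
move=> g0; elim: n => [|n IHn]; first exact: fps_comp1.
by rewrite !exprS fps_compM // IHn.
Qed.

Lemma coefs_comp_sqr f n :
  fps_comp f (sX ^+ 2) n = if odd n then 0 else f n./2.
Proof.
have coef_sqr i : fps_exp (sX ^+ 2) i n = (n == 2 * i)%N%:R :> R.
  by rewrite fps_expE -exprM fps_exprX [LHS]coefXn.
rewrite /fps_comp; under eq_bigr => i _ do rewrite coef_sqr.
case: ifP => odd_n.
  by rewrite big1 // => i _; case: eqP => [eq_n|]; rewrite ?mulr0 //; lia.
have lt_n : (n./2 < n.+1)%N by lia.
rewrite (bigD1 (Ordinal lt_n)) //= big1 ?addr0 => [|i].
  by case: eqP => [_|]; rewrite ?mulr1 //; lia.
by rewrite -val_eqE /= => neq_i; case: eqP; rewrite ?mulr0 //; lia.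
Qed.

End Agreement.

Lemma big_ord_even (V : nmodType) (F : nat -> V) m :
  (forall n, odd n -> F n = 0) ->
  \sum_(n < (2 * m).+1) F n = \sum_(j < m.+1) F (2 * j)%N.
Proof.
move=> F_odd; elim: m => [|m IHm]; first by rewrite !big_ord1.
rewrite [RHS]big_ord_recr -IHm /= (_ : 2 * m.+1 = (2 * m).+2)%N; last by lia.
rewrite 2!big_ord_recr /= F_odd ?addr0 //.
by rewrite /= oddM.
Qed.

(** * Decomposition along outermost circles *)

Section WordSums.
Variables (T : finType) (R : pzRingType).
Implicit Types f g : seq T -> R.

Definition sumw n f : R := \sum_(w : n.-tuple T) f w.

Lemma sumw0 f : sumw 0 f = f [::].
Proof.
rewrite /sumw (bigD1 [tuple]) //= big1 ?addr0 // => w /eqP[].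
exact: tuple0.
Qed.

Lemma sumw_cons n f : sumw n.+1 f = \sum_c sumw n (fun w => f (c :: w)).
Proof.
rewrite /sumw pair_big /=.
pose h (u : T * n.-tuple T) := [tuple of u.1 :: u.2].
pose h' (w : n.+1.-tuple T) := (thead w, [tuple of behead w]).
rewrite (reindex h) //; exists h'; last by move=> w _; rewrite [RHS]tuple_eta.
by move=> [c w] _; congr (_, _); apply: val_inj.
Qed.

Lemma eq_sumw n f g : (forall w, size w = n -> f w = g w) -> sumw n f = sumw n g.
Proof. by move=> eq_fg; apply: eq_bigr => w _; rewrite eq_fg ?size_tuple. Qed.

Lemma sumw_cat m n f :
  sumw (m + n) f = sumw m (fun u => sumw n (fun v => f (u ++ v))).
Proof.
elim: m f => [|m IHm] f; first by rewrite sumw0.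
by rewrite addSn !sumw_cons; apply: eq_bigr => c _; rewrite IHm.
Qed.

Lemma sumwD n f g : sumw n (fun w => f w + g w) = sumw n f + sumw n g.
Proof. exact: big_split. Qed.

Lemma sumw_mull n f a : sumw n (fun w => a * f w) = a * sumw n f.
Proof. by rewrite /sumw mulr_sumr. Qed.

Lemma sumw_mulr n f a : sumw n (fun w => f w * a) = sumw n f * a.
Proof. by rewrite /sumw mulr_suml. Qed.

Lemma sumw_eq0 n f : (forall w, size w = n -> f w = 0) -> sumw n f = 0.
Proof. by move=> f0; apply: big1 => w _; rewrite f0 ?size_tuple. Qed.

Lemma sumw_sum n I (r : seq I) (F : I -> seq T -> R) :
  sumw n (fun w => \sum_(i <- r) F i w) = \sum_(i <- r) sumw n (F i).
Proof. exact: exchange_big. Qed.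

End WordSums.

Local Notation ul := (true, true).
Local Notation dl := (false, false).

(* [closing 0 0 w]: the word [w] starts with a factor [v ++ [:: dl]] where [v]
   is a system; an extra letter [ul] in front of [w] opens a circle. *)
Fixpoint closing (p q : nat) (w : seq letter) : bool :=
  match w with
  | [::] => false
  | (true, true) :: w' => closing p.+1 q.+1 w'
  | (true, false) :: w' => if q is q'.+1 then closing p.+1 q' w' else false
  | (false, true) :: w' => if p is p'.+1 then closing p' q.+1 w' else false
  | (false, false) :: w' =>
    match p, q with
    | 0, 0 => true
    | p'.+1, q'.+1 => closing p' q' w'
    | _, _ => false
    end
  end%N.

Lemma closing_cat p q r s v w :
    dyck_from r (unzip1 v) -> dyck_from s (unzip2 v) ->
  closing (p + r) (q + s) (v ++ w) = closing p q w.
Proof.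
elim: v r s => [|[[] []] v IHv] r s /=.
- by move=> /eqP-> /eqP->; rewrite !addn0.
- by move=> d1 d2; rewrite -!addnS; apply: IHv.
- by case: s => // s d1 d2; rewrite addnS -addnS; apply: IHv.
- by case: r => // r d1 d2; rewrite addnS -addnS; apply: IHv.
- by case: r => // r; case: s => // s d1 d2; rewrite !addnS; apply: IHv.
Qed.

Lemma closing_insert p q pre v w : system v ->
  closing p q (pre ++ v ++ w) = closing p q (pre ++ w).
Proof.
case/andP=> d1 d2; elim: pre p q => [|[[] []] pre IHpre] p q /=.
- by rewrite -{1}[p]addn0 -{1}[q]addn0 closing_cat.
- exact: IHpre.
- by case: q.
- by case: p.
- by case: p => [|p]; case: q.
Qed.

(** At most one prefix brings both heights exactly to zero just before a letter [dl], because that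
    letter would take any longer prefix below zero. This turns the boolean into a sum over the
    position of the closing letter. *)
Lemma closing_sum p q w :
  (\sum_(k < size w) [&& dyck_from p (unzip1 (take k w)),
     dyck_from q (unzip2 (take k w)) & nth ul w k == dl] = closing p q w)%N.
Proof.
elim: w p q => [|[[] []] w IHw] p q /=; first by rewrite big_ord0.
- by rewrite big_ord_recl /= !andbF add0n -IHw.
- rewrite big_ord_recl /= !andbF add0n; case: q => [|q]; last by rewrite -IHw.
  by rewrite big1 // => i _; rewrite /= andbF.
- rewrite big_ord_recl /= !andbF add0n; case: p => [|p]; last by rewrite -IHw.
  by rewrite big1.
- rewrite big_ord_recl /= !andbT; case: p q => [|p] [|q] /=.
  + by rewrite big1.
  + by rewrite big1.
  + by rewrite big1 // => i _; rewrite /= andbF.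
  + by rewrite add0n -IHw.
Qed.

Definition opens_circle w :=
  if w is c :: w' then (c == ul) && closing 0 0 w' else false.

Fixpoint circle_free (w : seq letter) : bool :=
  if w is c :: w' then circle_free w' && ~~ opens_circle w else true.

Section InsertionSum.
Variables (R : comUnitRingType) (y : R).
Implicit Types f : seq letter -> R.

Definition defect (w : seq letter) : nat := ((size w)./2 - nloops w)%N.

Definition weight (w : seq letter) : R := if system w then y ^+ defect w else 0.

(** Stated for general [f] because the recursion on the first letter replaces the weight by the
    functions [skip_circles f c], which keep this property. *)
Definition insertable f := forall pre v post, system v ->
  f (pre ++ ul :: v ++ dl :: post) = weight v * f (pre ++ post).

Lemma dyck_even p d : dyck_from p d -> odd (size d) = odd p.
Proof.
by elim: d p => [|[] d IHd] [|p] //= /IHd ->; rewrite /= ?negbK.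
Qed.

Lemma system_even w : system w -> ~~ odd (size w).
Proof. by case/andP=> /dyck_even + _; rewrite size_map => ->. Qed.

Lemma system_wrap v : system v -> system (ul :: v ++ [:: dl]).
Proof.
case/andP=> d1 d2; rewrite /system /= unzip1_cat unzip2_cat.
by rewrite !(dyck_from_cat 1) ?(dyck_from_cat 0).
Qed.

Lemma system_insert pre v post : system v ->
  system (pre ++ v ++ post) = system (pre ++ post).
Proof.
case/andP=> d1 d2; rewrite /system !unzip1_cat !unzip2_cat.
by rewrite !dyck_cat_insert.
Qed.

Lemma insertable_weight : insertable weight.
Proof.
move=> pre v post sys_v; rewrite /weight sys_v.
have -> : ul :: v ++ dl :: post = (ul :: v ++ [:: dl]) ++ post by rewrite /= -catA.
rewrite (system_insert _ _ (system_wrap sys_v)).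
case: ifP => [sys_w|]; last by rewrite mulr0.
rewrite -exprD; congr (_ ^+ _).
have even_v := system_even sys_v; have even_w := system_even sys_w.
have le_v := nloops_le sys_v; have le_w := nloops_le sys_w.
rewrite /defect /= -catA nloops_circle // !size_cat /= size_cat /=.
by rewrite !size_cat in even_w le_w *; lia.
Qed.

Definition skip_circles f c : seq letter -> R :=
  fun w => if opens_circle (c :: w) then 0 else f (c :: w).

(** A circle with its content is a system, hence invisible to [closing]: inserting one does not
    change whether the first letter [c] opens a circle. *)
Lemma insertable_skip f c : insertable f -> insertable (skip_circles f c).
Proof.
move=> ins_f pre v post sys_v.
have avb : ul :: v ++ dl :: post = (ul :: v ++ [:: dl]) ++ post by rewrite /= -catA.
rewrite /skip_circles /= {1}avb (closing_insert _ _ _ _ (system_wrap sys_v)).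
by case: ifP => _; [rewrite mulr0 | rewrite -cat_cons ins_f].
Qed.

(** Either the first letter opens a circle with a content of length k, and insertability factors it
    out with n - 1 - k letters left, or it does not, which is the second sum. *)
Lemma sumw_first_letter n f : insertable f ->
  sumw n.+1 f = \sum_(k < n) sumw k weight * sumw (n.-1 - k) f
                + \sum_c sumw n (skip_circles f c).
Proof.
move=> ins_f; rewrite sumw_cons.
have split_c c : sumw n (fun w => f (c :: w)) =
    sumw n (fun w => if opens_circle (c :: w) then f (c :: w) else 0)
    + sumw n (skip_circles f c).
  rewrite -sumwD; apply: eq_sumw => w _; rewrite /skip_circles.
  by case: ifP; rewrite ?addr0 ?add0r.
under eq_bigr => c _ do rewrite split_c.
rewrite big_split /=; congr (_ + _).
rewrite (bigD1 ul) //= [X in _ + X]big1 ?addr0; last first.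
  by move=> c /negbTE c_neq; apply: sumw_eq0 => w _; rewrite c_neq.
transitivity (sumw n (fun w => \sum_(k < n)
    (if system (take k w) && (nth ul w k == dl) then f (ul :: w) else 0))).
  apply: eq_sumw => w size_w; rewrite -mulrb -closing_sum size_w -sumrMnr.
  by apply: eq_bigr => k _; rewrite -andbA mulrb.
rewrite sumw_sum; apply: eq_bigr => k _; move: (nat_of_ord k) (ltn_ord k) => {}k lt_kn.
have [m ->] : exists m, n = (k + m.+1)%N by exists (n - k.+1)%N; lia.
rewrite (_ : _ - k = m)%N; last by lia.
rewrite sumw_cat -sumw_mulr; apply: eq_sumw => v size_v.
rewrite sumw_cons (bigD1 dl) //= [X in _ + X]big1 ?addr0; last first.
  move=> c /negbTE c_neq; apply: sumw_eq0 => w _.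
  by rewrite nth_cat size_v ltnn subnn /= c_neq andbF.
rewrite -sumw_mull; apply: eq_sumw => w _.
rewrite nth_cat take_cat size_v ltnn subnn /= ?take0 cats0 andbT.
case: ifP => sys_v; last by rewrite /weight sys_v mul0r.
exact: (ins_f [::]).
Qed.

End InsertionSum.

Section CircleExpansion.
Variables (R : comUnitRingType) (y : R).
Implicit Types f : seq letter -> R.

Definition word_series f : fps R := fun n => sumw n f.

Definition weight_series : fps R := word_series (weight y).

Definition core_sum f n : R := sumw n (fun w => if circle_free w then f w else 0).

(** Linear in [word_series f], so [V] below solves it. The factor [sX ^+ 2] accounts for the two
    letters of the removed circle. *)
Lemma word_series_first_letter f : insertable y f ->
  word_series f = sX ^+ 2 * weight_series * word_series f
    + fps_const (f [::]) + sX * \sum_c word_series (skip_circles f c).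
Proof.
move=> ins_f; apply/funext => n; rewrite !coefsD expr2 -!mulrA !coefsXM.
case: n => [|n]; first by rewrite /word_series sumw0 [fps_const _ _]coefC add0r addr0.
rewrite [LHS](sumw_first_letter _ ins_f) [fps_const _ _]coefC addr0 coefs_sum.
by case: n => [|n]; rewrite coefsXM ?big_ord0.
Qed.

Variable V : fps R.
Hypothesis V_inv : V * (1 - sX ^+ 2 * weight_series) = 1.

(* A word is a circle-free word with a sequence of circles in each gap;
   [V] is the series of sequences of circles. *)
Lemma core_expansion N f : insertable y f ->
  agree N (word_series f)
    (\sum_(l < N.+1) sX ^+ l * V ^+ l.+1 * fps_const (core_sum f l)).
Proof.
have solve f' : insertable y f' -> word_series f' =
    V * (fps_const (f' [::]) + sX * \sum_c word_series (skip_circles f' c)).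
  move=> /word_series_first_letter eq_f; rewrite -[LHS]mul1r -V_inv -mulrA.
  by congr (V * _); apply/eqP; rewrite mulrBl mul1r subr_eq {1}eq_f -addrA addrC.
have core0 f' : core_sum f' 0 = f' [::] by rewrite /core_sum sumw0.
have coreS f' l : core_sum f' l.+1 = \sum_c core_sum (skip_circles f' c) l.
  rewrite /core_sum sumw_cons; apply: eq_bigr => c _; apply: eq_sumw => w _.
  by rewrite /skip_circles /=; case: (circle_free w) => //=; rewrite if_neg.
(* Each core letter costs one factor [sX] and one further gap [V]; [f] varies because the induction
   passes to [skip_circles f c]. *)
elim: N f => [|N IHN] f ins_f; rewrite (solve f ins_f).
  rewrite big_ord1 mul1r expr1 core0; apply: agree_mull => -[|//] _.
  by rewrite coefsD coefsXM addr0.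
rewrite big_ord_recl mulrDr mul1r expr1 core0; apply: agreeD => //.
have -> : \sum_(l < N.+1) sX ^+ lift ord0 l * V ^+ (lift ord0 l).+1
      * fps_const (core_sum f (lift ord0 l)) =
    V * (sX * \sum_c \sum_(l < N.+1) sX ^+ l * V ^+ l.+1
      * fps_const (core_sum (skip_circles f c) l)).
  rewrite exchange_big /= !mulr_sumr; apply: eq_bigr => l _.
  by rewrite -mulr_sumr -rmorph_sum coreS !(exprS _ l.+1) (exprS sX); ring.
apply/agree_mull/agree_mulX/agree_sum => c.
exact/IHN/insertable_skip.
Qed.

End CircleExpansion.

Section CoreSeries.
Variables (R : comUnitRingType) (y : R).

Lemma core_sum_odd n : odd n -> core_sum (weight y) n = 0.
Proof.
move=> odd_n; apply: sumw_eq0 => w size_w; case: ifP => // _.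
rewrite /weight; case: ifP => // /system_even.
by rewrite size_w odd_n.
Qed.

Definition half_weight_series : fps R := fun n => weight_series y (2 * n)%N.

Lemma weight_series_comp : weight_series y = fps_comp half_weight_series (sX ^+ 2).
Proof.
apply/funext => n; rewrite coefs_comp_sqr; case: ifP => odd_n.
  apply: sumw_eq0 => w size_w; rewrite /weight; case: ifP => // /system_even.
  by rewrite size_w odd_n.
by rewrite /half_weight_series mul2n halfK odd_n subn0.
Qed.

(** The letter-counting expansion contains only even powers, so it is read at order 2m after
    composing with [sX ^+ 2]. A core of 2l letters has 2l+1 gaps, whence the exponent of [V]. *)
Lemma half_core_expansion V m : V * (1 - sX * half_weight_series) = 1 ->
  half_weight_series m =
  (\sum_(l < m.+1) sX ^+ l * V ^+ (2 * l)%N.+1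
     * fps_const (core_sum (weight y) (2 * l)%N)) m.
Proof.
move=> V_inv; pose g : fps R := sX ^+ 2.
have g0 : g 0%N = 0 by rewrite /g expr2 coefsXM.
pose W := fps_comp V g.
have W_inv : W * (1 - sX ^+ 2 * weight_series y) = 1.
  transitivity (fps_comp (V * (1 - sX * half_weight_series)) g).
    rewrite fps_compM // fps_compB // fps_compM // fps_comp1 fps_compX //.
    by rewrite weight_series_comp.
  by rewrite V_inv fps_comp1.
rewrite [LHS](core_expansion W_inv (insertable_weight y) (leqnn (2 * m)%N)) !coefs_sum.
rewrite (big_ord_even (F := fun l => (sX ^+ l * W ^+ l.+1
    * fps_const (core_sum (weight y) l)) (2 * m)%N)); last first.
  by move=> n /core_sum_odd ->; rewrite rmorph0 mulr0.
apply: eq_bigr => l _; rewrite exprM -/g.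
rewrite (_ : g ^+ l * W ^+ _ = fps_comp (sX ^+ l * V ^+ (2 * l)%N.+1) g); last first.
  by rewrite fps_compM // !fps_comp_exp // fps_compX.
rewrite ![_ * fps_const _]mulrC !coefs_constM.
by rewrite coefs_comp_sqr oddM /= !mul2n doubleK.
Qed.

End CoreSeries.

(** * Circle-free words *)

Lemma hgt_take d n k : (k <= n)%N -> hgt (take n d) k = hgt d k.
Proof.
by elim: d n k => [|c d IHd] [|n] [|k] //= le_k; rewrite IHd.
Qed.

Lemma hgt_drop d n k : hgt (drop n d) k = hgt d (n + k) - hgt d n.
Proof.
elim: d n k => [|c d IHd] [|n] k; rewrite ?hgt0 ?subr0 ?add0n ?drop0 //=.
by rewrite IHd; lia.
Qed.

Lemma matched_inside d i j : matched d i j ->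
  dyck (take (j - i.+1) (drop i.+1 d)).
Proof.
move=> m_ij; have [lt_j up_i down_j] := matched_letters m_ij.
case/matchedP: m_ij => lt_ij eqh allh.
have hi := hgtS d i; have hj := hgtS d j.
rewrite (ltn_trans lt_ij lt_j) up_i in hi; rewrite lt_j (negbTE down_j) in hj.
have size_v : size (take (j - i.+1) (drop i.+1 d)) = (j - i.+1)%N.
  by rewrite size_take size_drop; case: ifP; lia.
have h0 k : (k <= j - i.+1)%N ->
    0 <= hgt (take (j - i.+1) (drop i.+1 d)) k.
  move=> le_k; rewrite hgt_take // hgt_drop.
  by have := allh (i.+1 + k)%N; lia.
apply/dyckP; split=> [k|]; last first.
  by rewrite size_v hgt_take // hgt_drop subnKC //; lia.
have [|lt_k] := leqP k (j - i.+1); first exact: h0.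
by rewrite hgt_oversize size_v ?h0 // ltnW.
Qed.

Lemma circle_free_drop n w : circle_free w -> circle_free (drop n w).
Proof. by elim: n w => [|n IHn] [|c w] //= /andP[/IHn]. Qed.

Lemma circle_free_not_opens w : circle_free w -> ~~ opens_circle w.
Proof. by case: w => //= c w /andP[]. Qed.

(** The suffix starting at an arch common to both pairings opens a circle: the factor inside the
    arch is a Dyck word for each pairing. *)
Lemma circle_free_matched w i j : circle_free w ->
  matched (unzip1 w) i j -> matched (unzip2 w) i j -> False.
Proof.
move=> /(circle_free_drop i)/circle_free_not_opens/negP cf m1 m2; apply: cf.
have [lt_j up1 down1] := matched_letters m1; have [_ up2 down2] := matched_letters m2.
have lt_ij : (i < j)%N by case/matchedP: m1.
rewrite size_map in lt_j; have lt_i := ltn_trans lt_ij lt_j.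
have nth1 k : (k < size w)%N ->
    nth (true, true) w k = (nth false (unzip1 w) k, nth false (unzip2 w) k).
  by move=> lt_k; rewrite !(nth_map (true, true)) // -surjective_pairing.
rewrite (drop_nth (true, true)) // nth1 // up1 up2 /=.
rewrite -(cat_take_drop (j - i.+1) (drop i.+1 w)) drop_drop subnK //.
rewrite (drop_nth (true, true) lt_j) nth1 // (negbTE down1) (negbTE down2).
rewrite (@closing_cat 0 0 0 0) //.
  by rewrite [unzip1 _]map_take [map _ (drop _ _)]map_drop; apply: matched_inside.
by rewrite [unzip2 _]map_take [map _ (drop _ _)]map_drop; apply: matched_inside.
Qed.

Section Coefficients.
Implicit Types w : seq letter.

Local Notation Xweight := (weight ('X : {poly rat})).

Lemma coef_weight w s : (Xweight w)`_s = (system w && (defect w == s))%:R.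
Proof.
by rewrite /weight; case: system; rewrite ?coef0 // coefXn eq_sym.
Qed.

(** With m loops, s = l - m. Having m >= 1 gives s < l, and 4m <= 2l gives l <= 2s. *)
Lemma core_sum_supp l s : ~~ (s < l <= 2 * s)%N -> (0 < l)%N ->
  (core_sum Xweight (2 * l)%N)`_s = 0.
Proof.
move=> nsupp l_gt0; rewrite coef_sum; apply: big1 => w _.
have size_w := size_tuple w; case: ifP => [cf_w|]; last by rewrite coef0.
rewrite coef_weight; case sys_w: system => //=; case: eqP => // eq_s.
have le4 := nloops_circle_free sys_w (fun i j => @circle_free_matched w i j cf_w).
have loops_gt0 : (0 < nloops w)%N by rewrite nloops_gt0 // size_w; lia.
exfalso; move: nsupp loops_gt0 le4; rewrite -eq_s /defect size_w.
by move: (nloops w) => m; lia.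
Qed.

Lemma core_sum0 : core_sum Xweight 0 = 1.
Proof.
rewrite /core_sum sumw0 /= /weight /= /defect.
by rewrite sub0n.
Qed.

(** A nonempty system has at least one loop, so a positive defect [r] requires n > r; this matches
    the zero coefficients of [meandric_gf] up to [r]. *)
Lemma half_weight_coef n r : (0 < r)%N ->
  (half_weight_series ('X : {poly rat}) n)`_r = meandric_gf r n.
Proof.
move=> r_gt0; rewrite /meandric_gf /half_weight_series /weight_series /word_series.
rewrite /sumw coef_sum; under eq_bigr => w _ do rewrite coef_weight.
case: ltnP => [lt_r|le_n].
  rewrite meandric_numberE -sum1_card natr_sum [RHS]big_mkcond /=.
  apply: eq_bigr => w _; rewrite inE.
  case sys_w: system => //=; have le2 := nloops_le sys_w.
  rewrite /defect size_tuple in le2 *; move: (nloops w) le2 => m le2.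
  by case: eqP; case: eqP => // h1 h2; exfalso; lia.
apply: big1 => w _; case sys_w: system => //=.
have le2 := nloops_le sys_w; have loops_gt0 := nloops_gt0 (w := w).
rewrite /defect size_tuple in le2 loops_gt0 *.
move: (nloops w) le2 loops_gt0 => m le2 loops_gt0.
by case: eqP => // eq_r; exfalso; lia.
Qed.

End Coefficients.

(** * Rationality of the coefficients *)

Section RationalCoefficients.
Variable R : comUnitRingType.
Local Notation A := (fps R).
Local Notation B := (fps A).
Variable w : A.

Definition eval_at (p : {poly R}) : A := (map_poly (@fps_const R) p).[w].

Definition poly_at (d : nat) (a : A) : Prop :=
  exists2 p : {poly R}, (size p <= d.+1)%N & a = eval_at p.

Lemma poly_at_le d e a : (d <= e)%N -> poly_at d a -> poly_at e a.
Proof. by move=> le_de [p sp ->]; exists p => //; apply: leq_trans sp _. Qed.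

Lemma poly_at0 d : poly_at d 0.
Proof. by exists 0; rewrite ?size_poly0 // /eval_at rmorph0 horner0. Qed.

Lemma poly_atD d a b : poly_at d a -> poly_at d b -> poly_at d (a + b).
Proof.
move=> [p sp ->] [q sq ->]; exists (p + q); last by rewrite /eval_at rmorphD hornerD.
by rewrite (leq_trans (size_polyD _ _)) // geq_max sp.
Qed.

Lemma poly_atM d e a b : poly_at d a -> poly_at e b -> poly_at (d + e) (a * b).
Proof.
move=> [p sp ->] [q sq ->]; exists (p * q); last by rewrite /eval_at rmorphM hornerM.
by rewrite (leq_trans (size_polyMleq _ _)) //; lia.
Qed.

Lemma poly_at_const c : poly_at 0 (fps_const c).
Proof.
by exists c%:P; rewrite ?size_polyC_leq1 // /eval_at map_polyC hornerC.
Qed.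

Lemma poly_atX : poly_at 1 w.
Proof. by exists 'X; rewrite ?size_polyX // /eval_at map_polyX hornerX. Qed.

Lemma poly_at_1sub : poly_at 1 (1 - w).
Proof.
exists (1 - 'X); last by rewrite /eval_at rmorphB rmorph1 /= map_polyX !hornerE.
by rewrite (leq_trans (size_polyD _ _)) // size_polyN size_polyX size_poly1.
Qed.

Lemma poly_at_exp d n a : poly_at d a -> poly_at (n * d) (a ^+ n).
Proof.
move=> da; elim: n => [|n IHn].
  by rewrite expr0 -(rmorph1 (@fps_const R)); apply: poly_at_const.
by rewrite exprS mulSn; apply: poly_atM.
Qed.

(** All three exponents are additive in [r], so products preserve the property. It is the form
    suited to [U]; the coefficients of [G] satisfy the sharper [rational_at]. *)
Definition tame_at (H : B) r :=
  exists2 q, poly_at (3 * r) q & (1 - w) ^+ (2 * r) * H r = w ^+ r * q.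

Lemma tame_sum I (s : seq I) (P : pred I) (F : I -> A) d m n :
  (forall i, P i -> exists2 q, poly_at d q & (1 - w) ^+ m * F i = w ^+ n * q) ->
  exists2 q, poly_at d q & (1 - w) ^+ m * (\sum_(i <- s | P i) F i) = w ^+ n * q.
Proof.
move=> tF; elim/big_rec: _ => [|i a Pi [q dq eq_q]].
  by exists 0; [apply: poly_at0 | rewrite !mulr0].
have [p dp eq_p] := tF i Pi.
by exists (p + q); [apply: poly_atD | rewrite !mulrDr eq_p eq_q].
Qed.

(** Bounded by [N] because inside the main induction only the indices below the current one are
    available. *)
Lemma tameM N (H K : B) : (forall r, (r <= N)%N -> tame_at H r) ->
  (forall r, (r <= N)%N -> tame_at K r) ->
  forall r, (r <= N)%N -> tame_at (H * K) r.
Proof.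
move=> tH tK r le_r; rewrite /tame_at coefsM; apply: tame_sum => i _.
have le_i := leq_ord i; move: (nat_of_ord i) le_i => {}i le_i.
have [|p dp eq_p] := tH i; first by lia.
have [|q dq eq_q] := tK (r - i)%N; first by lia.
exists (p * q).
  by rewrite (_ : 3 * r = 3 * i + 3 * (r - i))%N; [apply: poly_atM | lia].
rewrite (_ : 2 * r = 2 * i + 2 * (r - i))%N; last by lia.
by rewrite exprD mulrACA eq_p eq_q mulrACA -exprD subnKC.
Qed.

Lemma tame1 r : tame_at 1 r.
Proof.
case: r => [|r].
  exists 1; last by rewrite !mulr1.
  by rewrite -(rmorph1 (@fps_const R)); apply: poly_at_const.
by exists 0; [apply: poly_at0 | rewrite coefs1 !mulr0].
Qed.

Lemma tameX N (H : B) n : (forall r, (r <= N)%N -> tame_at H r) ->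
  forall r, (r <= N)%N -> tame_at (H ^+ n) r.
Proof.
move=> tH; elim: n => [|n IHn]; first by move=> r _; apply: tame1.
by rewrite exprS; apply: tameM.
Qed.

Variables (G U : B) (k : nat -> nat -> R).
Hypothesis G0 : G 0%N = 0.
Hypothesis U_inv : U * (1 - fps_const w * G) = 1.
Hypothesis k_supp : forall l s, ~~ (s < l <= 2 * s)%N -> (0 < l)%N -> k l s = 0.
Hypothesis G_eq : forall N,
  agree N (G - fps_const w * G - fps_const w * (G * G))
    (\sum_(l < 2 * N) fps_const w ^+ l.+1 * U ^+ (2 * l.+1)
       * (fun s => fps_const (k l.+1 s) : A)).

Lemma coefs_constX (a : A) n (H : B) r : (fps_const a ^+ n * H) r = a ^+ n * H r.
Proof. by rewrite -rmorphXn coefs_constM. Qed.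

Definition rational_at r :=
  exists2 p, poly_at (3 * r - 3) p & (1 - w) ^+ (2 * r - 1) * G r = w ^+ r.+1 * p.

(** In U = 1 + w G U the vanishing of [G 0] leaves only lower coefficients of [U] on the right, so
    strong induction applies. *)
Lemma tame_U N : (forall r, (0 < r <= N)%N -> rational_at r) ->
  forall r, (r <= N)%N -> tame_at U r.
Proof.
move=> ratG; have U_eq : U = 1 + fps_const w * (G * U).
  by rewrite -{1}U_inv; ring.
elim/ltn_ind=> r IHr le_r.
have [q1 d1 e1] := tame1 r.
suff [q2 d2 e2] : exists2 q, poly_at (3 * r) q &
    (1 - w) ^+ (2 * r) * (\sum_(i < r.+1) w * (G i * U (r - i)%N)) = w ^+ r * q.
  exists (q1 + q2); first exact: poly_atD.
  by rewrite U_eq coefsD coefs_constM coefsM !mulrDr e1 mulr_sumr e2.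
apply: tame_sum => -[i lt_i] _ /=; have [->|i_gt0] := posnP i.
  by exists 0; [apply: poly_at0 | rewrite G0 mul0r !mulr0].
have [|p dp eq_p] := ratG i; first by lia.
have [||q dq eq_q] := IHr (r - i)%N; [by lia | by lia |].
(* One [w] comes from the equation, one from the spare power in [rational_at], and 1 - w raises the
   exponent 2i - 1 to 2i. These three degrees fill the gap between 3r - 3 and 3r. *)
exists (w * w * (1 - w) * (p * q)).
  rewrite (_ : 3 * r = (1 + 1 + 1) + ((3 * i - 3) + 3 * (r - i)))%N; last by lia.
  apply: poly_atM; last exact: poly_atM.
  by apply: poly_atM (poly_at_1sub); apply: poly_atM; apply: poly_atX.
transitivity (w * (1 - w) * ((1 - w) ^+ (2 * i - 1) * G i)
              * ((1 - w) ^+ (2 * (r - i)) * U (r - i)%N)).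
  rewrite (_ : 2 * r = (2 * i - 1).+1 + 2 * (r - i))%N; last by lia.
  by rewrite exprD exprS; ring.
rewrite eq_p eq_q (_ : r = i + (r - i))%N; last by lia.
by rewrite addKn exprD exprS; ring.
Qed.

Lemma rational_coefs r : (0 < r)%N -> rational_at r.
Proof.
elim/ltn_ind: r => r IHr r_gt0.
have tU : forall i, (i <= r.-1)%N -> tame_at U i.
  by apply: tame_U => i le_i; apply: IHr; lia.
suff [p dp eq_p] : exists2 p, poly_at (3 * r - 3) p &
    (1 - w) ^+ (2 * r - 2) * ((1 - w) * G r) = w ^+ r.+1 * p.
  exists p => //; rewrite -eq_p (_ : 2 * r - 1 = (2 * r - 2).+1)%N; last by lia.
  by rewrite exprS; ring.
have := G_eq (leqnn r).
rewrite !coefsB !coefs_constM => /eqP; rewrite subr_eq => /eqP eq_G.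
rewrite mulrBl mul1r eq_G coefs_sum.
have [p1 d1 e1] : exists2 p, poly_at (3 * r - 3) p & (1 - w) ^+ (2 * r - 2) *
    (\sum_(i < r.+1) w * (G i * G (r - i)%N)) = w ^+ r.+1 * p.
  apply: tame_sum => -[i lt_i] _ /=; have [->|i_gt0] := posnP i.
    by exists 0; [apply: poly_at0 | rewrite G0 mul0r !mulr0].
  have [->|i_neq] := eqVneq i r.
    by exists 0; [apply: poly_at0 | rewrite subnn G0 !mulr0].
  have [||p dp eq_p] := IHr i; [lia | lia |].
  have [||q dq eq_q] := IHr (r - i)%N; [lia | lia |].
  exists (w * w * (p * q)).
    apply: (@poly_at_le ((1 + 1) + ((3 * i - 3) + (3 * (r - i) - 3)))); first by lia.
    by apply: poly_atM; apply: poly_atM => //; apply: poly_atX.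
  transitivity (w * ((1 - w) ^+ (2 * i - 1) * G i)
              * ((1 - w) ^+ (2 * (r - i) - 1) * G (r - i)%N)).
    rewrite (_ : 2 * r - 2 = (2 * i - 1) + (2 * (r - i) - 1))%N; last by lia.
    by rewrite exprD; ring.
  rewrite eq_p eq_q (_ : r.+1 = (i + (r - i)).+1)%N; last by lia.
  by rewrite !exprS !exprD; ring.
rewrite mulrDr coefsM [w * _]mulr_sumr e1.
suff [p2 d2 ->] : exists2 p, poly_at (3 * r - 3) p & (1 - w) ^+ (2 * r - 2) *
    (\sum_(l < 2 * r) (fps_const w ^+ l.+1 * U ^+ (2 * l.+1)
       * (fun s => fps_const (k l.+1 s) : A)) r) = w ^+ r.+1 * p.
  by exists (p2 + p1); [apply: poly_atD | rewrite mulrDr].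
apply: tame_sum => -[l lt_l] _ /=.
rewrite coefsM; apply: tame_sum => -[i lt_i] _ /=.
(* Here s = r - i and the core has half-length [l.+1]. A nonempty range forces s > 0, so [U] is used
   only at indices below [r]. *)
have [/andP[lt_s le_l]|nsupp] := boolP (r - i < l.+1 <= 2 * (r - i))%N; last first.
  by exists 0; [apply: poly_at0 | rewrite k_supp // rmorph0 !mulr0].
have [|q dq eq_q] := tameX (2 * l.+1) tU (r := i); first by lia.
exists (w ^+ (l - (r - i)) * q * (1 - w) ^+ (2 * (r - i) - 2)
        * fps_const (k l.+1 (r - i)%N)).
  (* Since l + 1 <= 2s, this is at most (s - 1) + 3i + (2s - 2) = 3r - 3. *)
  apply: (@poly_at_le ((((l - (r - i)) * 1 + 3 * i) + (2 * (r - i) - 2) * 1) + 0)%N).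
    by lia.
  apply: poly_atM; last exact: poly_at_const.
  apply: poly_atM; last exact: poly_at_exp poly_at_1sub.
  by apply: poly_atM => //; apply: poly_at_exp poly_atX.
rewrite coefs_constX (_ : 2 * r - 2 = 2 * i + (2 * (r - i) - 2))%N; last by lia.
transitivity (w ^+ l.+1 * ((1 - w) ^+ (2 * i) * (U ^+ (2 * l.+1)) i)
  * (1 - w) ^+ (2 * (r - i) - 2) * fps_const (k l.+1 (r - i)%N)).
  by rewrite exprD; ring.
rewrite eq_q (_ : w ^+ r.+1 = w ^+ i * w ^+ (r - i).+1); last first.
  by rewrite -exprD; congr (_ ^+ _); lia.
rewrite (_ : w ^+ l.+1 = w ^+ (l - (r - i)) * w ^+ (r - i).+1); last first.
  by rewrite -exprD; congr (_ ^+ _); lia.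
by ring.
Qed.

End RationalCoefficients.

(** * Meandric series *)

Lemma sum_ord_stable (V : nmodType) (F : nat -> V) n N :
  (n <= N)%N -> (forall l, (n <= l)%N -> F l = 0) ->
  \sum_(l < N) F l = \sum_(l < n) F l.
Proof.
move=> le_nN F0; rewrite (big_ord_widen N F le_nN) [RHS]big_mkcond.
by apply: eq_bigr => l _; case: ltnP => // /F0.
Qed.

Local Notation A := (fps rat).
Local Notation B := (fps A).

Section Swap.

(* [swap H r] is the coefficient of [y ^ r] in [H], where ['X] plays [y]. *)
Definition swap (H : fps {poly rat}) : B := fun r n => (H n)`_r.

Fact swap_is_zmod_morphism : zmod_morphism swap.
Proof. by move=> H K; apply/funext => r; apply/funext => n; apply: coefB. Qed.

Fact swap_is_monoid_morphism : monoid_morphism swap.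
Proof.
split=> [|H K]; apply/funext => r; apply/funext => n.
  rewrite /swap !coefs1; case: n => [|n]; first by rewrite coef1; case: r.
  by rewrite coef0; case: r.
rewrite /swap !coefsM coef_sum coefs_sum.
under eq_bigr => i _ do rewrite coefM.
by rewrite exchange_big; apply: eq_bigr.
Qed.

HB.instance Definition _ := GRing.isZmodMorphism.Build (fps {poly rat}) B
  swap swap_is_zmod_morphism.
HB.instance Definition _ := GRing.isMonoidMorphism.Build (fps {poly rat}) B
  swap swap_is_monoid_morphism.

Lemma swap_X : swap sX = fps_const (sX : A).
Proof.
apply/funext => r; apply/funext => n; rewrite /swap [sX n]coefX.
rewrite [fps_const _ _]coefC; case: r => [|r] /=.
  by rewrite [fps_of_poly _ _](coefX rat); case: eqP; rewrite ?coef1 ?coef0.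
by case: eqP; rewrite ?coef1 ?coef0.
Qed.

Lemma swap_const c : swap (fps_const c) = (fun r => fps_const c`_r).
Proof.
apply/funext => r; apply/funext => n; rewrite /swap [fps_const _ _]coefC [fps_const _ _]coefC.
by case: n => [|n] //=; rewrite coef0.
Qed.

End Swap.

Section MeandricSeries.

Local Notation H := (half_weight_series ('X : {poly rat})).

Definition meandric_series : B := swap H.
Local Notation M := meandric_series.

Definition core_coef l s : rat := (core_sum (weight ('X : {poly rat})) (2 * l)%N)`_s.

Local Notation K l := ((fun s => fps_const (core_coef l s) : A) : B).
Local Notation t := (fps_const (sX : A)).

Lemma core_coef0 : K 0 = 1.
Proof.
by rewrite /core_coef muln0 core_sum0 -swap_const !rmorph1.
Qed.

(** The support of the cores bounds l by 2N up to order N in y, uniformly in the power m of t;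
    [half_core_expansion] truncates at a length depending on m instead. Both truncations drop only
    zero terms. *)
Lemma meandric_series_expansion : exists2 V : B, V * (1 - t * M) = 1 &
  forall N, agree N M (\sum_(l < (2 * N).+1) t ^+ l * V ^+ (2 * l)%N.+1 * K l).
Proof.
have unit_tH : 1 - sX * H \is a GRing.unit.
  by rewrite unfold_in /= /fps_unit coefsB coefsXM subr0 unitr1.
pose V : fps {poly rat} := (1 - sX * H)^-1.
have V_inv : V * (1 - sX * H) = 1 by rewrite mulVr.
exists (swap V); first by rewrite -swap_X -rmorphM -(rmorph1 swap) -rmorphB -rmorphM V_inv.
move=> N r le_r; apply/funext => m; rewrite coefs_sum coefs_sum.
pose Z l := sX ^+ l * V ^+ (2 * l)%N.+1
  * fps_const (core_sum (weight ('X : {poly rat})) (2 * l)%N).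
have swapZ l : swap (Z l) = t ^+ l * swap V ^+ (2 * l)%N.+1 * K l.
  by rewrite /Z !rmorphM !rmorphXn /= swap_X swap_const.
transitivity (\sum_(l < (2 * N).+1) (Z l m)`_r); last first.
  by apply: eq_bigr => l _; rewrite -swapZ.
rewrite [LHS](congr1 (fun p : {poly rat} => p`_r) (half_core_expansion m V_inv)).
rewrite coefs_sum coef_sum.
have Z_large l : (m < l)%N -> (Z l m)`_r = 0.
  move=> lt_ml; rewrite /Z -mulrA coefsM big1 ?coef0 // => i _.
  rewrite fps_exprX [fps_of_poly _ _]coefXn; case: eqP => [eq_i|]; rewrite ?mul0r //.
  by exfalso; move: (ltn_ord i); rewrite eq_i ltnS leqNgt lt_ml.
have Z_order l : (2 * N < l)%N -> (Z l m)`_r = 0.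
  move=> lt_Nl; rewrite /Z mulrC coefs_constM coefM big1 // => i _.
  by have lt_i := ltn_ord i; rewrite core_sum_supp ?mul0r //; lia.
have [le_m|lt_N] := leqP m (2 * N).
  by rewrite [RHS](sum_ord_stable (F := fun l => (Z l m)`_r) (n := m.+1)).
by rewrite (sum_ord_stable (F := fun l => (Z l m)`_r) (n := (2 * N).+1)) // ltnW.
Qed.

Let c0 : A := M 0%N.
Let w : A := c0 - 1.

(** At y = 0 only the empty core survives, so [c0] equals [V 0%N]; this is the Catalan equation. *)
Lemma catalan_eq : c0 * (1 - sX * c0) = 1.
Proof.
have [V V_inv expM] := meandric_series_expansion.
have c0V : c0 = V 0%N.
  by rewrite /c0 (expM 0%N) // big_ord1 core_coef0 mulr1 mul1r expr1.
have := congr1 (fun f : B => f 0%N) V_inv.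
by rewrite coefsM big_ord1 coefsB coefs_constM -c0V.
Qed.

Lemma meandric_rational r : (0 < r)%N -> exists2 p : {poly rat},
  (size p <= (3 * r - 3).+1)%N &
  (1 - w) ^+ (2 * r - 1) * M r = c0 * w ^+ r.+1 * eval_at w p.
Proof.
move=> r_gt0; have [V V_inv expM] := meandric_series_expansion.
pose ci := 1 - sX * c0; have c_inv : c0 * ci = 1 := catalan_eq.
pose i : A -> B := @fps_const A.
(* [ci] is the inverse of [c0]: dividing [M] and [V] by their values at y = 0 turns t into w times
   the square of [ci]. *)
pose G : B := fps_const ci * M - 1; pose U : B := fps_const ci * V.
have w_ci2 : w * (ci * ci) = sX.
  have -> : w * (ci * ci) = (c0 * ci) * ci - ci ^+ 2 by rewrite /w; ring.
  rewrite c_inv mul1r; transitivity (ci * (1 - ci)); first by ring.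
  have -> : 1 - ci = sX * c0 by rewrite /ci; ring.
  by rewrite mulrCA [ci * _]mulrC c_inv mulr1.
have w_ci : w * ci = 1 - ci by rewrite /w mulrBl c_inv mul1r.
have G0 : G 0%N = 0.
  by rewrite /G coefsB coefs_constM coefs1 -/c0 [ci * _]mulrC c_inv subrr.
have eq_tM : 1 - t * M = fps_const ci * (1 - fps_const w * G).
  have -> : fps_const ci * (1 - fps_const w * G) =
      fps_const ci + fps_const (w * ci) - fps_const (w * (ci * ci)) * M.
    by rewrite /G !rmorphM /=; ring.
  by rewrite w_ci2 w_ci -rmorphD [ci + _]addrC subrK rmorph1.
have U_inv : U * (1 - fps_const w * G) = 1.
  by rewrite -[RHS]V_inv eq_tM /U; ring.
have tV2 : t * V ^+ 2 = fps_const w * U ^+ 2.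
  by rewrite -w_ci2 /U !rmorphM /=; ring.
have G_eq N : agree N (G - fps_const w * G - fps_const w * (G * G))
    (\sum_(l < 2 * N) fps_const w ^+ l.+1 * U ^+ (2 * l.+1)%N * K l.+1).
  (* Multiplying by the inverse of [V] makes the left side (1 + G)(1 - w G) and leaves even powers
     of [V] on the right, so that t V^2 = w U^2 eliminates t. *)
  have := agree_mull (1 - t * M) (expM N).
  have -> : (1 - t * M) * M = 1 + (G - fps_const w * G - fps_const w * (G * G)).
    transitivity ((1 + G) * (1 - fps_const w * G)); last by ring.
    by rewrite eq_tM /G; ring.
  have -> : (1 - t * M) * (\sum_(l < (2 * N).+1) t ^+ l * V ^+ (2 * l)%N.+1 * K l)
      = 1 + \sum_(l < 2 * N) fps_const w ^+ l.+1 * U ^+ (2 * l.+1)%N * K l.+1.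
    rewrite big_ord_recl mulrDr mulr_sumr; congr (_ + _).
      by rewrite core_coef0 mulr1 mul1r [V ^+ _]expr1 mulrC.
    apply: eq_bigr => l _; rewrite lift0.
    transitivity ((t * V ^+ 2) ^+ l.+1 * K l.+1 * (V * (1 - t * M))).
      by rewrite exprMn -exprM (exprS _ (2 * l.+1)); ring.
    by rewrite V_inv mulr1 tV2 exprMn -exprM.
  by move=> h n le_n; apply: (addrI ((1 : B) n)); rewrite -!coefsD h.
have [p sp eq_p] : rational_at w G r.
  apply: (rational_coefs G0 U_inv _ G_eq r_gt0).
  by move=> l s nsupp l_gt0; apply: core_sum_supp.
case: sp eq_p => q sq -> eq_p; exists q => //.
have -> : M r = c0 * G r.
  case: r r_gt0 {p eq_p q sq} => // r _.
  by rewrite /G coefsB coefs_constM coefs1 subr0 mulrA c_inv mul1r.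
by rewrite mulrCA eq_p mulrA.
Qed.

End MeandricSeries.

Local Notation M := meandric_series.

(** * The substitution t = w/(1+w)^2 *)

Section Substitution.

Definition catalan_subst : A := fps_div sX (fps_of_poly ((1 + 'X) ^+ 2)).
Local Notation g := catalan_subst.

Lemma coefs0_exp (f : A) n : (f ^+ n) 0%N = f 0%N ^+ n.
Proof. by elim: n => // n IHn; rewrite !exprS coefsM big_ord1 IHn. Qed.

Lemma unit_1addX n : fps_of_poly ((1 + 'X) ^+ n) 0%N \is a @GRing.unit rat.
Proof.
rewrite rmorphXn /= coefs0_exp unitrX // rmorphD rmorph1 /= coefsD.
by rewrite (_ : (fps_of_poly 'X : A) 0%N = 0) ?addr0 ?unitr1 // [LHS]coefX.
Qed.

Lemma unit_1subX n : fps_of_poly ((1 - 'X) ^+ n) 0%N \is a @GRing.unit rat.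
Proof.
rewrite rmorphXn /= coefs0_exp unitrX // rmorphB rmorph1 /= coefsB.
by rewrite (_ : (fps_of_poly 'X : A) 0%N = 0) ?subr0 ?unitr1 // [LHS]coefX.
Qed.

Lemma catalan_substE : (1 + sX) ^+ 2 * g = sX.
Proof.
have := unit_1addX 2; rewrite /g fps_divE rmorphXn rmorphD rmorph1 /= => u.
by rewrite mulrCA fps_mulVr // mulr1.
Qed.

Lemma catalan_subst0 : g 0%N = 0.
Proof. by rewrite /g fps_divE coefsXM. Qed.
Hint Resolve catalan_subst0 : core.

Lemma catalan_subst_exp n :
  fps_div (fps_of_poly 'X^n) (fps_of_poly ((1 + 'X) ^+ (2 * n)%N)) = g ^+ n.
Proof.
apply: (fps_unit_inj (unit_1addX (2 * n))); rewrite fps_divE.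
rewrite mulrCA (fps_mulVr (unit_1addX (2 * n))) mulr1.
by rewrite exprM !rmorphXn -exprMn rmorphD rmorph1 catalan_substE.
Qed.

(** The difference of two solutions z and z' is annihilated by 1 - g (z + z'), which is invertible
    because [g] has no constant term. *)
Lemma catalan_unique (z : A) : z = 1 + g * z ^+ 2 -> z = 1 + sX.
Proof.
move=> z_eq; apply/eqP; rewrite -subr_eq0; apply/eqP.
have X_eq : 1 + sX = 1 + g * (1 + sX) ^+ 2 by rewrite [g * _]mulrC catalan_substE.
apply: (@fps_unit_inj _ (1 - g * (z + (1 + sX)))).
  by rewrite coefsB coefsM big_ord1 catalan_subst0 mul0r subr0 unitr1.
rewrite mulr0.
transitivity ((z - (1 + g * z ^+ 2)) - ((1 + sX) - (1 + g * (1 + sX) ^+ 2))).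
  by ring.
by rewrite -z_eq -X_eq !subrr.
Qed.

Lemma fps_comp_const (a : rat) : fps_comp (fps_const a) g = fps_const a.
Proof.
apply/funext => k; rewrite /fps_comp big_ord_recl big1 ?addr0 => [|i _].
  rewrite [fps_const _ _]coefC /= [fps_const _ _]coefC /fps_one.
  by case: k => [|k]; rewrite ?mulr1 ?mulr0.
by rewrite [fps_const _ _]coefC mul0r.
Qed.

Lemma fps_comp_catalan : fps_comp (M 0%N) g = 1 + sX.
Proof.
apply: catalan_unique.
have M0_eq : M 0%N = 1 + sX * (M 0%N * M 0%N).
  by rewrite -[X in X + _]catalan_eq; ring.
rewrite [LHS](congr1 ((@fps_comp rat)^~ g) M0_eq) fps_compD fps_comp1.
by rewrite !fps_compM // fps_compX // expr2.
Qed.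

Lemma fps_comp_eval (p : {poly rat}) :
  fps_comp (eval_at (M 0%N - 1) p) g = fps_of_poly p.
Proof.
elim/poly_ind: p => [|p c IHp].
  by rewrite /eval_at !rmorph0 horner0 fps_comp0.
rewrite /eval_at !rmorphD !rmorphM /= map_polyC map_polyX hornerMXaddC.
rewrite fps_compD fps_compM // -/(eval_at _ p) IHp fps_comp_const.
by rewrite fps_compB fps_comp_catalan fps_comp1 [1 + _]addrC addrK.
Qed.

End Substitution.

Theorem theorem5p6 (r : nat) (hr : (1 <= r)%N) :
  exists P : {poly rat},
    let Fw := fps_comp (meandric_gf r)
                (fps_div (fps_of_poly 'X) (fps_of_poly ((1 + 'X) ^+ 2))) in
    [/\ ((size P).-1 <= 3 * r - 3)%N,
        fps_is_sum r.+1
          (fun n k => (meandric_number n (n - r))%:R *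
             fps_div (fps_of_poly 'X^n)
                     (fps_of_poly ((1 + 'X) ^+ (2 * n))) k)
          Fw
      & Fw =1 fps_mul
                (fps_div (fps_of_poly ('X^(r + 1) * (1 + 'X)))
                         (fps_of_poly ((1 - 'X) ^+ (2 * r - 1))))
                (fps_of_poly P)].
Proof.
have [p sp eq_p] := meandric_rational hr; exists p; rewrite /= -/catalan_subst.
have g0 := catalan_subst0.
have gfE : meandric_gf r = M r.
  by apply/funext => n; rewrite /meandric_series /swap half_weight_coef.
split; first by move: sp; case: (size p).
  (* Beyond [k] the powers of the substituted series do not reach degree [k]; the other bound allows
     the range to be completed down to 0, where [meandric_gf] vanishes. *)
  move=> k; exists (maxn r.+1 k.+1) => N; rewrite geq_max => /andP[lt_rN lt_kN].
  pose F n := meandric_gf r n * (catalan_subst ^+ n) k.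
  transitivity (\sum_(r.+1 <= n < N) F n).
    apply: eq_big_nat => n /andP[lt_rn _].
    by rewrite catalan_subst_exp /F /meandric_gf lt_rn.
  have -> : \sum_(r.+1 <= n < N) F n = \sum_(0 <= n < N) F n.
    rewrite [RHS](@big_cat_nat _ _ _ r.+1) //= [X in _ = X + _]big_nat_cond.
    rewrite [X in _ = X + _]big1 ?add0r // => n /andP[/andP[_ lt_nr] _].
    by rewrite /F /meandric_gf ltnNge -ltnS lt_nr mul0r.
  rewrite big_mkord (sum_ord_stable (n := k.+1)) // => [|n lt_kn].
    by apply: eq_bigr => n _; rewrite fps_expE.
  by rewrite /F coefs_expr_lt ?mulr0.
move=> n; congr (_ n); rewrite gfE fps_divE.
(* Composition sends [M 0%N - 1] to the variable, hence polynomials in it to actual polynomials; the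
   factor [M 0%N] becomes the 1 + w of the claim. *)
have := congr1 (fun f => fps_comp f catalan_subst) eq_p.
rewrite !fps_compM // !fps_comp_exp // !fps_compB // fps_comp1 fps_comp_catalan.
rewrite fps_comp_eval [1 + sX]addrC addrK => eq_F.
apply: (fps_unit_inj (unit_1subX (2 * r - 1))).
rewrite rmorphXn rmorphB rmorph1 eq_F.
transitivity ((1 - sX) ^+ (2 * r - 1) * fps_inv ((1 - sX) ^+ (2 * r - 1)) *
   (sX ^+ (r + 1) * (1 + sX) * fps_of_poly p)).
  have := unit_1subX (2 * r - 1); rewrite rmorphXn rmorphB rmorph1 /= => u.
  by rewrite fps_mulVr // mul1r addn1; ring.
rewrite rmorphM rmorphXn rmorphD rmorph1 /=.
set v := fps_inv _; set q := fps_of_poly p.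
by transitivity ((1 - sX) ^+ (2 * r - 1) * (sX ^+ (r + 1) * (1 + sX) * v * q)); first ring.
Qed.
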